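(* Let $K$ be an arbitrary field and let $I\subset R:=K[x_1,\ldots,x_n]$ be an ideal generated by monomials of degree two. Assume that $I$ does not have a linear resolution, and let $r$ be the smallest integer ($\geq 4$) such that the graded Betti number $\beta_{i,r}$ of $I$ is nonzero for some $i\leq r-3$. If $r=4$, assume moreover that $I$ is squarefree. Then a multidegree $\underline{s}\in\mathbb{N}^n$ with $|\underline{s}|=r$ satisfies $\beta_{r-3,\underline{s}}\neq 0$ if and only if the monomial $x_1^{s_1}\cdots x_n^{s_n}$ is the product of the variables $x_{i_1},\ldots,x_{i_r}$ corresponding to the vertices $(i_1),\ldots,(i_r)$ of an induced $r$-cycle of $G(I)^c$. Moreover, for such an $\underline{s}$, $\beta_{r-3,\underline{s}}=1$.
   Context: $\beta_{i,j}$ (resp. $\beta_{i,\underline{s}}$, $\underline{s}\in\mathbb{N}^n$) is the number of generators of degree $j$ (resp. multidegree $\underline{s}$) in the $i$-th step of the minimal graded (resp. $\mathbb{N}^n$-graded) free resolution of $I$ (not of $R/I$), where step $0$ corresponds to minimal generators of $I$. Here $|\underline{s}|=s_1+\cdots+s_n$. $I$ has a linear resolution if $\beta_{i,j}=0$ whenever $j\neq i+2$. $G(I)$ is the graph with vertex set $\{(1),\ldots,(n)\}$ and edges $(i,j)$, $1\le i\le j\le n$, with $x_ix_j\in I$ (loops $(i,i)$ correspond to $x_i^2\in I$). $G(I)^c$ is the simple graph on the same vertices whose edges are the $(i,j)$, $i<j$, that are not edges of $G(I)$. For $t\ge3$, a $t$-cycle is a subgraph with edges $(v_1,v_2),(v_2,v_3),\ldots,(v_t,v_1)$,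 $v_1,\ldots,v_t$ distinct; it is induced if no edge of the graph other than those of the cycle joins two of the $v_i$. *)

(* Defs.v *)
From mathcomp Require Import all_boot all_order all_algebra.
From mathcomp Require Export mpoly.

Set Implicit Arguments.
Unset Strict Implicit.
Unset Printing Implicit Defensive.

Import GRing.Theory.
Local Open Scope ring_scope.

Section MonomialIdeals.
Variables (n : nat) (K : fieldType).
Implicit Type I : {mpoly K[n]} -> Prop.

Definition monomial_span (S : seq 'X_{1..n}) (p : {mpoly K[n]}) : Prop :=
  exists c : 'X_{1..n} -> {mpoly K[n]}, p = \sum_(m <- S) c m * 'X_[m].

Definition generated_by_monomials (P : pred 'X_{1..n}) I : Prop :=
  exists2 S : seq 'X_{1..n}, all P S & forall p, I p <-> monomial_span S p.

Definition quadratic_monomial_ideal I : Prop :=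
  generated_by_monomials (fun m => mdeg m == 2%N) I.

Definition squarefree_monomial (m : 'X_{1..n}) : bool :=
  [forall i, (m i <= 1)%N].

Definition squarefree_ideal I : Prop :=
  generated_by_monomials squarefree_monomial I.

Definition graph_of I (i j : 'I_n) : Prop := I ('X_i * 'X_j).

Definition compl_graph I (i j : 'I_n) : Prop := i != j /\ ~ graph_of I i j.

End MonomialIdeals.

(* [v] lists the vertices of the cycle; [ordS] is the successor modulo [t].   *)
Definition induced_cycle (V : Type) (e : V -> V -> Prop) (t : nat)
    (v : 'I_t -> V) : Prop :=
  [/\ (3 <= t)%N, injective v,
      forall a, e (v a) (v (ordS a))
    & forall a b, e (v a) (v b) -> b = ordS a \/ a = ordS b].

Section Resolutions.
Variables (n : nat) (K : fieldType).
Implicit Type I : {mpoly K[n]} -> Prop.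

(* F_i is the module of row vectors of length [rk i]; the differential        *)
(* F_{i+1} -> F_i is [u |-> u *m diff i], and the augmentation F_0 -> R is    *)
(* [u |-> u *m aug].                                                          *)
Record free_sequence := FreeSequence {
  rk : nat -> nat;
  aug : 'cV[{mpoly K[n]}]_(rk 0);
  diff : forall i, 'M[{mpoly K[n]}]_(rk i.+1, rk i)
}.

(* Exactness of the F_i, extended by F_0 -> I -> 0.                           *)
Definition free_resolution I (F : free_sequence) : Prop :=
  [/\ forall p, I p <-> exists u : 'rV_(rk F 0), p%:M = u *m aug F,
      forall u : 'rV_(rk F 0),
        u *m aug F = 0 <-> exists w : 'rV_(rk F 1), u = w *m diff F 0
    & forall i (u : 'rV_(rk F i.+1)),
        u *m diff F i = 0 <-> exists w : 'rV_(rk F i.+2), u = w *m diff F i.+1].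

(* The image of F_{i+1} lies in (x_1, ..., x_n) F_i.                          *)
Definition minimal (F : free_sequence) : Prop :=
  forall i j k, (diff F i j k)@_0%MM = 0.

(* [d i k] is the degree of the k-th basis element of F_i; all maps are       *)
(* homogeneous of degree 0.                                                   *)
Definition multigraded (F : free_sequence)
    (d : forall i, 'I_(rk F i) -> 'X_{1..n}) : Prop :=
  (forall k m, m \in msupp (aug F k 0) -> m = d 0 k) /\
  (forall i j k m, m \in msupp (diff F i j k) -> (m + d i k)%MM = d i.+1 j).

Definition graded (F : free_sequence) (d : forall i, 'I_(rk F i) -> nat) : Prop :=
  (forall k m, m \in msupp (aug F k 0) -> mdeg m = d 0 k) /\
  (forall i j k m, m \in msupp (diff F i j k) -> (mdeg m + d i k)%N = d i.+1 j).

Record minimal_multigraded_resolution I := MinimalMultigradedResolution {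
  res :> free_sequence;
  mdegree : forall i, 'I_(rk res i) -> 'X_{1..n};
  res_exact : free_resolution I res;
  res_minimal : minimal res;
  res_multigraded : multigraded mdegree
}.

Record minimal_graded_resolution I := MinimalGradedResolution {
  gres :> free_sequence;
  degree : forall i, 'I_(rk gres i) -> nat;
  gres_exact : free_resolution I gres;
  gres_minimal : minimal gres;
  gres_graded : graded degree
}.

Lemma multigraded_graded (F : free_sequence)
    (d : forall i, 'I_(rk F i) -> 'X_{1..n}) :
  multigraded d -> graded (fun i k => mdeg (d i k)).
Proof.
case=> Haug Hdiff; split=> [k m /Haug -> //|i j k m /Hdiff <-].
by rewrite mdegD.
Qed.

(* A minimal N^n-graded resolution is a minimal graded one for the total      *)
(* degree of its generators.                                                  *)
Definition coarsen I (F : minimal_multigraded_resolution I) :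
    minimal_graded_resolution I :=
  MinimalGradedResolution (res_exact F) (@res_minimal I F)
    (multigraded_graded (res_multigraded F)).

Definition multigraded_betti I (F : minimal_multigraded_resolution I)
    (i : nat) (s : 'X_{1..n}) : nat :=
  #|[set k : 'I_(rk F i) | mdegree k == s]|.

Definition graded_betti I (F : minimal_graded_resolution I) (i j : nat) : nat :=
  #|[set k : 'I_(rk F i) | degree k == j]|.

Definition linear_resolution I (F : minimal_graded_resolution I) : Prop :=
  forall i j, j <> (i + 2)%N -> graded_betti F i j = 0%N.

(* [i + 3 <= r] is i <= r - 3 over the integers.                              *)
Definition has_nonlinear_betti I (F : minimal_graded_resolution I) (r : nat) :
    Prop :=
  exists2 i, (i + 3 <= r)%N & graded_betti F i r <> 0%N.

Definition first_nonlinear_degree I (F : minimal_graded_resolution I) (r : nat) :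
    Prop :=
  has_nonlinear_betti F r /\
  forall r', has_nonlinear_betti F r' -> (r <= r')%N.

End Resolutions.

Definition supported_on_induced_cycle (n : nat) (K : fieldType)
    (I : {mpoly K[n]} -> Prop) (r : nat) (s : 'X_{1..n}) : Prop :=
  exists2 v : 'I_r -> 'I_n, induced_cycle (compl_graph I) v
    & 'X_[s] = \prod_(a < r) 'X_(v a) :> {mpoly K[n]}.

(* Main.v *)
Require Import Defs.
From Stdlib Require Import Classical_Prop.
From mathcomp Require Import all_boot all_order all_algebra zify.

(** Resolve R/I by R <- F_0 <- F_1 <- ... and tensor with the Koszul complex of
    the variables.  In multidegree s the rows of this double complex are exact
    because F is a resolution, and the columns are exact except at generators of
    degree s.  Zigzags therefore identify the generators of F_p of degree s with
    the Koszul homology of R/I in homological degree p + 1 and multidegree s.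

    For |s| = r and p = r - 3 only monomials of degree 1, 2, 3 outside I occur.
    If s is squarefree the homology is H^1 of the clique complex of G(I)^c on
    the support of s.  A cocycle with nonzero sum along some closed walk has
    nonzero sum along a shortest such walk, which must be an induced cycle of
    length t >= 4.  An induced t-cycle gives beta_{t-3} = 1, so t = r by
    minimality of r, and the cycle uses the whole support.  If s is not
    squarefree, a nontrivial class produces x_v^2 in I and a multidegree of
    total degree 4 (either 2v + a + b or 2v + 2w) with nonzero beta_1, which
    forces r = 4, where I is assumed to be squarefree. *)

Set Implicit Arguments.
Unset Strict Implicit.
Unset Printing Implicit Defensive.

Import GRing.Theory.
Local Open Scope ring_scope.

Lemma sum_neq0 (K : zmodType) (J : finType) (P : pred J) (f : J -> K) :
  \sum_(j | P j) f j != 0 -> exists2 j, P j & f j != 0.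
Proof.
move=> h; apply/(@exists_inP _ P (fun j => f j != 0)); apply: contraNT h.
rewrite negb_exists_in => /forall_inP h; apply/eqP/big1 => j Pj.
by have /negPn/eqP := h j Pj.
Qed.

(** * The Koszul complex in a fixed multidegree *)

Section SetMonomials.
Variable n : nat.
Implicit Types (t A B : {set 'I_n}) (a b c : 'I_n) (s : 'X_{1..n}).

Lemma addmCA (m1 m2 m3 : 'X_{1..n}) : (m1 + (m2 + m3) = m2 + (m1 + m3))%MM.
Proof. by rewrite !addmA (addmC m1). Qed.

Lemma lem_add2 (a b c d : 'X_{1..n}) :
  (a <= c -> b <= d -> a + b <= c + d)%MM.
Proof.
by move=> /mnm_lepP h1 /mnm_lepP h2; apply/mnm_lepP => i; rewrite !mnmDE leq_add.
Qed.

Lemma lem_subDr (s a b : 'X_{1..n}) : (b <= s)%MM ->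
  (a <= s - b)%MM = (a + b <= s)%MM.
Proof.
move=> /mnm_lepP h; apply/mnm_lepP/mnm_lepP => g v; have := g v; rewrite !mnmE.
  by rewrite leq_subRL // addnC.
by rewrite leq_subRL // addnC.
Qed.

Lemma subm_self (m : 'X_{1..n}) : (m - m)%MM = 0%MM.
Proof. by apply/mnmP => i; rewrite mnmBE subnn mnm0E. Qed.

Definition mset A : 'X_{1..n} := [multinom (i \in A : nat) | i < n].

Definition mnm_supp s : {set 'I_n} := [set v | (0 < s v)%N].

Lemma mset_set0 : mset (set0 : {set 'I_n}) = 0%MM.
Proof. by apply/mnmP=> i; rewrite !mnmE inE. Qed.

Lemma mset_sub t t' : t \subset t' -> (mset t <= mset t')%MM.
Proof.
move=> /subsetP h; apply/mnm_lepP => i; rewrite !mnmE.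
by case: (boolP (i \in t)) => // /h ->.
Qed.

Lemma mset1 a : mset [set a] = U_(a)%MM.
Proof. by apply/mnmP => i; rewrite mnmE mnm1E inE eq_sym. Qed.

Lemma msetU1 a A : a \notin A -> mset (a |: A) = (U_(a) + mset A)%MM.
Proof.
move=> aA; apply/mnmP => i; rewrite mnmDE mnm1E !mnmE !inE eq_sym.
by case: eqP => [<-|]; rewrite ?(negbTE aA).
Qed.

Lemma mdeg_mset A : mdeg (mset A) = #|A|.
Proof.
rewrite mdegE -sum1_card [RHS]big_mkcond; apply: eq_bigr => i _.
by rewrite mnmE; case: (i \in A).
Qed.

Lemma mset_le s A : (mset A <= s)%MM = (A \subset mnm_supp s).
Proof.
apply/mnm_lepP/subsetP => h i.
  by move=> iA; have := h i; rewrite mnmE iA inE.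
rewrite mnmE; case: (boolP (i \in A)) => // /h; by rewrite inE.
Qed.

(** The Koszul coefficient on a set [t] belongs to the monomial [s - t]. When [t] is the complement
    of [A] in the support, this monomial is [A] times the excess of [s] over its support. *)
Lemma mset_compl s A : A \subset mnm_supp s ->
  (s - mset (mnm_supp s :\: A) = mset A + (s - mset (mnm_supp s)))%MM.
Proof.
move=> /subsetP As; apply/mnmP => i; have := As i.
rewrite !mnmBE mnmDE mnmBE !mnmE !inE.
by case: (i \in A) => [/(_ isT)|_]; case: (s i) => [|k] //=; lia.
Qed.

Lemma supp_mset A : mnm_supp (mset A) = A.
Proof. by apply/setP => i; rewrite inE mnmE; case: (i \in A). Qed.

Lemma supp_mset_add (A : {set 'I_n}) m : mnm_supp m \subset A ->
  mnm_supp (mset A + m)%MM = A.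
Proof.
move=> /subsetP mA; apply/setP => i; have := mA i; rewrite !inE mnmDE mnmE.
by case: (i \in A); rewrite // add0n => h; apply/negbTE/negP => /h.
Qed.

Lemma excess_add (A : {set 'I_n}) m : (mset A + m - mset A)%MM = m.
Proof. by rewrite addmC addmK. Qed.

End SetMonomials.

Section Koszul.
Variables (n : nat) (K : fieldType) (s : 'X_{1..n}).
Implicit Types (t : {set 'I_n}) (v w : 'I_n) (x : {set 'I_n} -> K).

(** Counting elements outside [t] gives the simplicial coboundary sign once [t] is replaced by its
    complement. *)
Definition ksign t v : K :=
  (-1) ^+ #|[set w in mnm_supp s :\: t | (w < v)%N]|.

(** In a fixed multidegree the monomial factor of the basis element [t] is determined by [t], so a
    chain is stored as scalars and multiplication by a variable leaves only a sign. *)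
Definition kbd x t : K := \sum_(v in mnm_supp s :\: t) ksign t v * x (v |: t).

Lemma ksign_sqr t v : ksign t v * ksign t v = 1.
Proof. by rewrite /ksign -signr_odd -expr2 sqrr_sign. Qed.

Lemma ksignU t v w : v \in mnm_supp s :\: t -> v != w ->
  ksign (v |: t) w = (-1) ^+ (v < w)%N * ksign t w.
Proof.
move=> vt nvw; rewrite /ksign.
have -> : [set u in mnm_supp s :\: (v |: t) | (u < w)%N]
        = [set u in mnm_supp s :\: t | (u < w)%N] :\ v.
  apply/setP=> u; rewrite !inE negb_or; case: (u == v) => //=.
rewrite [in RHS](cardsD1 v) !inE; move: vt; rewrite !inE => ->.
by case: (v < w)%N; rewrite /= ?add0n ?mul1r // exprD expr1 mulrA mulrNN !mul1r.
Qed.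

Lemma ksign_anti t v w : v \in mnm_supp s :\: t -> w \in mnm_supp s :\: t -> v != w ->
  ksign t v * ksign (v |: t) w = - (ksign t w * ksign (w |: t) v).
Proof.
move=> vt wt nvw; rewrite ksignU // ksignU // 1?eq_sym //.
rewrite mulrCA [in RHS]mulrCA [ksign t w * _]mulrC -mulNr; congr (_ * _).
move: nvw; rewrite -val_eqE /= neq_ltn.
by case: (ltngtP v w) => //= _; rewrite ?opprK.
Qed.

Lemma kbd_kbd x t : kbd (kbd x) t = 0.
Proof.
(* The double sum is split into [v < w] and [w < v]; exchanging the names in the second half pairs
   each term with its opposite. *)
pose G v w := ksign t v * (ksign (v |: t) w * x (w |: (v |: t))).
have -> : kbd (kbd x) t = \sum_(v in mnm_supp s :\: t) \sum_(w in mnm_supp s :\: t)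
   ((if (v < w)%N then G v w else 0) + (if (w < v)%N then G v w else 0)).
  apply: eq_bigr => v vt; rewrite mulr_sumr [LHS]big_mkcond [RHS]big_mkcond.
  apply: eq_bigr => w _; rewrite !inE -/(G v w).
  have [->|nwv] := eqVneq w v; first by rewrite ltnn addr0 if_same.
  rewrite /= ; case: (_ && _) => //.
  move: nwv; rewrite -val_eqE /=.
  by case: (ltngtP v w) => //= _; rewrite ?addr0 ?add0r.
under eq_bigr => v _ do rewrite big_split /=.
rewrite big_split /= [X in _ + X]exchange_big /= -big_split /=.
apply: big1 => v vt; rewrite -big_split /=; apply: big1 => w wt.
case: ifP => vw; last by rewrite addr0.
rewrite /G !mulrA ksign_anti //; last by rewrite -val_eqE neq_ltn vw.
by rewrite setUCA mulNr addNr.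
Qed.

Definition kcone v0 x t : K :=
  if v0 \in t then ksign (t :\ v0) v0 * x (t :\ v0) else 0.

(** Adjoining [v0] is a contracting homotopy of the full Koszul complex on the support, so it
    provides a primitive of every cycle. *)
Lemma kcone_homotopy v0 x t : v0 \in mnm_supp s -> kbd x =1 (fun=> 0) ->
  x t = kbd (kcone v0 x) t.
Proof.
move=> v0s x0; have [v0t|v0t] := boolP (v0 \in t); last first.
  have v0st : v0 \in mnm_supp s :\: t by rewrite inE v0t.
  rewrite /kbd (bigD1 v0) //= big1 => [|v /andP[vt nv]].
    by rewrite /kcone setU11 setU1K // mulrA ksign_sqr mul1r addr0.
  by rewrite /kcone !inE eq_sym (negbTE nv) (negbTE v0t) mulr0.
set t' := t :\ v0; have tE : t = v0 |: t' by rewrite setD1K.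
have v0t' : v0 \in mnm_supp s :\: t' by rewrite /t' in_setD in_setD1 eqxx.
have := x0 t'; rewrite /kbd (bigD1 v0) //= -tE => /eqP; rewrite addr_eq0 => /eqP e.
apply: (mulfI (x := ksign t' v0)); first by rewrite /ksign signr_eq0.
rewrite e mulr_sumr -sumrN; apply: eq_big => v.
  by rewrite /t' !inE; case: (v =P v0) => [->|] //=; rewrite ?v0t ?andbF //= andbT.
case/andP=> vt' nv; rewrite /kcone !inE v0t orbT.
have nv' : v0 != v by rewrite eq_sym.
have -> : (v |: t) :\ v0 = v |: t'.
  by apply/setP=> u; rewrite !inE; case: eqP => [->|//]; rewrite (negbTE nv').
have -> : ksign t v = ksign (v0 |: t') v by rewrite -tE.
rewrite -mulNr !mulrA; congr (_ * _).
by rewrite ksign_anti // mulNr -mulrA ksign_sqr mulr1.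
Qed.

End Koszul.

(** * Comparison of a resolution with the Koszul complex *)

Section DoubleComplex.
Variables (n : nat) (K : fieldType) (s : 'X_{1..n}).
Variables (E : nat -> finType) (deg : forall i, E i -> 'X_{1..n}).
Variable D : forall i, E i.+1 -> E i -> K.
Variables (I : pred 'X_{1..n}) (e0 : E 0).
Implicit Types (t : {set 'I_n}) (i p : nat).

Hypothesis E0 : forall e : E 0, e = e0.
Hypothesis deg0 : deg e0 = 0%MM.
Hypothesis D_D : forall i (j : E i.+2) (l : E i), \sum_k D j k * D k l = 0.
Hypothesis D_lt : forall i (j : E i.+1) (k : E i),
  D j k != 0 -> (deg k <= deg j)%MM /\ deg k != deg j.
Hypothesis D_exact : forall m i (u : E i.+1 -> K),
  (forall e, u e != 0 -> (deg e <= m)%MM) ->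
  (forall l, \sum_k u k * D k l = 0) ->
  exists w : E i.+2 -> K, (forall e, w e != 0 -> (deg e <= m)%MM) /\
    forall k, u k = \sum_j w j * D j k.
Hypothesis D0_I : forall j : E 1, D j e0 != 0 -> I (deg j).
Hypothesis D0_exact : forall m, I m ->
  exists w : E 1 -> K, (forall e, w e != 0 -> (deg e <= m)%MM) /\
    \sum_j w j * D j e0 = 1.
Hypothesis I_up : forall m m', (m <= m')%MM -> I m -> I m'.

(** Bidegree (i, p) of the resolution tensored with the Koszul complex, in multidegree [s]. The
    monomial cofactor [s - deg e - t] is implied, so only scalars are kept. *)
Definition dchain i p (x : E i -> {set 'I_n} -> K) : Prop :=
  forall e t, x e t != 0 -> #|t| = p /\ (deg e + mset t <= s)%MM.

Definition hbd i (x : E i.+1 -> {set 'I_n} -> K) (e : E i) t : K :=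
  \sum_j x j t * D j e.

Definition vbd i (x : E i -> {set 'I_n} -> K) (e : E i) t : K :=
  kbd s (x e) t.

Lemma dchain_hbd i p (x : E i.+1 -> {set 'I_n} -> K) :
  dchain p x -> dchain p (hbd x).
Proof.
move=> cx e t /sum_neq0[j _]; rewrite mulf_eq0 negb_or => /andP[/cx[-> h1] /D_lt[h2 _]].
by split=> //; apply: lepm_trans h1; apply: lem_add2 (lepm_refl _).
Qed.

(** Minimality enters here: a nonzero entry of [D] strictly raises the degree, and degrees in a
    chain are bounded by [s]. *)
Lemma hbd_top i p (x : E i.+1 -> {set 'I_n} -> K) e t :
  dchain p x -> hbd x e t != 0 -> deg e != s.
Proof.
move=> cx /sum_neq0[j _]; rewrite mulf_eq0 negb_or => /andP[/cx[_ h1] /D_lt[h2 ne]].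
apply: contraNneq ne => es; apply/eqP/mnmP => v.
have /mnm_lepP/(_ v) := h2; have /mnm_lepP/(_ v) := h1.
rewrite -es mnmDE => a b; apply/eqP; rewrite eqn_leq b.
by apply: leq_trans a; apply: leq_addr.
Qed.

Lemma dchain_vbd i p (x : E i -> {set 'I_n} -> K) :
  dchain p.+1 x -> dchain p (vbd x).
Proof.
move=> cx e t /sum_neq0[v vt]; rewrite mulf_eq0 negb_or => /andP[_ /cx[h1 h2]].
move: vt h1; rewrite inE => /andP[vt _]; rewrite cardsU1 vt add1n => -[->].
split=> //; apply: lepm_trans h2; apply: lem_add2; first exact: lepm_refl.
exact/mset_sub/subsetUr.
Qed.

Lemma vbd0 i (x : E i -> {set 'I_n} -> K) e t : dchain 0 x -> vbd x e t = 0.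
Proof.
move=> cx; apply: big1 => v _; have [->|/cx[]] := eqVneq (x e (v |: t)) 0.
  by rewrite mulr0.
by move/eqP; rewrite cards_eq0 => /eqP/setP/(_ v); rewrite !inE eqxx.
Qed.

Lemma vbd_hbd i (x : E i.+1 -> {set 'I_n} -> K) e t :
  vbd (hbd x) e t = hbd (vbd x) e t.
Proof.
rewrite /vbd /hbd /kbd.
under eq_bigr => v _ do rewrite mulr_sumr.
rewrite exchange_big /=; apply: eq_bigr => j _; rewrite mulr_suml.
by apply: eq_bigr => v _; rewrite mulrA.
Qed.

Lemma hbd_hbd i (x : E i.+2 -> {set 'I_n} -> K) e t : hbd (hbd x) e t = 0.
Proof.
rewrite /hbd; under eq_bigr => j _ do rewrite mulr_suml.
rewrite exchange_big /=; apply: big1 => k _.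
by under eq_bigr => j _ do rewrite -mulrA; rewrite -mulr_sumr D_D mulr0.
Qed.

Lemma vbdD i (x y : E i -> {set 'I_n} -> K) a b e t :
  vbd (fun e t => a * x e t + b * y e t) e t = a * vbd x e t + b * vbd y e t.
Proof.
rewrite /vbd /kbd !mulr_sumr -big_split; apply: eq_bigr => v _ /=.
by rewrite mulrDr !(mulrCA (ksign _ _ _ _)).
Qed.

Lemma hbdD i (x y : E i.+1 -> {set 'I_n} -> K) a b e t :
  hbd (fun e t => a * x e t + b * y e t) e t = a * hbd x e t + b * hbd y e t.
Proof.
rewrite /hbd !mulr_sumr -big_split; apply: eq_bigr => v _ /=.
by rewrite mulrDl !mulrA.
Qed.

Lemma dchainD i p (x y : E i -> {set 'I_n} -> K) a b :
  dchain p x -> dchain p y -> dchain p (fun e t => a * x e t + b * y e t).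
Proof.
move=> cx cy e t; have [->|/cx//] := eqVneq (x e t) 0.
by have [->|/cy//] := eqVneq (y e t) 0; rewrite !mulr0 addr0 eqxx.
Qed.

Lemma eq_vbd i (x y : E i -> {set 'I_n} -> K) :
  (forall e t, x e t = y e t) -> forall e t, vbd x e t = vbd y e t.
Proof. by move=> xy e t; apply: eq_bigr => v _; rewrite xy. Qed.

Lemma eq_hbd i (x y : E i.+1 -> {set 'I_n} -> K) :
  (forall e t, x e t = y e t) -> forall e t, hbd x e t = hbd y e t.
Proof. by move=> xy e t; apply: eq_bigr => v _; rewrite xy. Qed.

(** The column over a generator [e] is contracted by any variable whose exponent in [deg e] is below
    that in [s]. Only generators of degree [s] lack such a variable, and the last hypothesis
    excludes them. *)
Lemma vbd_exact i p (x : E i -> {set 'I_n} -> K) : dchain p x ->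
  (forall e t, vbd x e t = 0) -> (forall e t, x e t != 0 -> deg e != s) ->
  exists y, dchain p.+1 y /\ forall e t, x e t = vbd y e t.
Proof.
move=> cx x0 xs.
have H e : exists y : {set 'I_n} -> K,
    (forall t, y t != 0 -> #|t| = p.+1 /\ (deg e + mset t <= s)%MM) /\
    forall t, x e t = kbd s y t.
  have [/existsP[v lt_v]|] := boolP [exists v, (deg e v < s v)%N]; last first.
    rewrite negb_exists => /forallP h; exists (fun=> 0); split.
      by move=> t; rewrite eqxx.
    move=> t; rewrite /kbd big1 => [|v _]; last by rewrite mulr0.
    apply/eqP; apply: contraT => nz; case/negP: (xs _ _ nz).
    apply/eqP/mnmP => v; apply/eqP; rewrite eqn_leq.
    have := h v; rewrite -leqNgt => ->; rewrite andbT.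
    have [_ /mnm_lepP/(_ v)] := cx _ _ nz; rewrite mnmDE; apply: leq_trans.
    exact: leq_addr.
  have vs : v \in mnm_supp s by rewrite inE (leq_ltn_trans _ lt_v).
  exists (kcone s v (x e)); split=> [t|t]; last exact: (kcone_homotopy _ vs (x0 e)).
  rewrite /kcone; case: ifP => [vt|]; last by rewrite eqxx.
  rewrite mulf_eq0 negb_or => /andP[_ /cx[h1 /mnm_lepP h2]].
  split; first by rewrite (cardsD1 v) vt h1.
  apply/mnm_lepP => w; have := h2 w; rewrite !mnmDE !mnmE !inE.
  by case: eqP => [->|_] //= _; rewrite vt addn1.
have [y /all_and2[Hy1 Hy2]] := fin_all_exists H.
exists y; split=> [e t|e t]; [exact: Hy1|exact: Hy2].
Qed.

(** For fixed [t] a row is the resolution in multidegree [s - t], so exactness is applied to each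
    [t] separately. *)
Lemma hbd_exact i p (x : E i.+1 -> {set 'I_n} -> K) : dchain p x ->
  (forall e t, hbd x e t = 0) ->
  exists y : E i.+2 -> {set 'I_n} -> K,
    dchain p y /\ forall e t, x e t = hbd y e t.
Proof.
move=> cx x0.
have H t : exists y : E i.+2 -> K,
    (forall e, y e != 0 -> #|t| = p /\ (deg e + mset t <= s)%MM) /\
    forall e, x e t = \sum_j y j * D j e.
  have [/andP[/eqP ct ts]|nt] := boolP ((#|t| == p) && (mset t <= s)%MM).
    have [||w [w1 w2]] := @D_exact (s - mset t)%MM i (x^~ t).
    - by move=> e /cx[_]; rewrite lem_subDr.
    - by move=> l; apply: x0.
    by exists w; split=> // e /w1; rewrite lem_subDr.
  exists (fun=> 0); split=> [e|e]; first by rewrite eqxx.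
  rewrite big1 => [|j _]; last by rewrite mul0r.
  apply/eqP; apply: contraNT nt => /cx[-> h]; rewrite eqxx /=.
  exact: lepm_trans (lem_addl _ _) h.
have [y /all_and2[Hy1 Hy2]] := fin_all_exists H.
exists (fun e t => y t e); split=> [e t|e t]; [exact: Hy1|exact: Hy2].
Qed.

Lemma hbd_exact0 p (x : E 0 -> {set 'I_n} -> K) : dchain p x ->
  (forall e t, x e t != 0 -> I (s - mset t)%MM) ->
  exists y : E 1 -> {set 'I_n} -> K,
    dchain p y /\ forall e t, x e t = hbd y e t.
Proof.
move=> cx xI.
have H t : exists y : E 1 -> K,
    (forall e, y e != 0 -> #|t| = p /\ (deg e + mset t <= s)%MM) /\
    x e0 t = \sum_j y j * D j e0.
  have [x0|nz] := eqVneq (x e0 t) 0.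
    exists (fun=> 0); split=> [e|]; first by rewrite eqxx.
    by rewrite x0 big1 // => j _; rewrite mul0r.
  have [w [w1 w2]] := D0_exact (xI _ _ nz).
  have [ct] := cx _ _ nz; rewrite deg0 add0m => ts.
  exists (fun j => x e0 t * w j); split.
    by move=> e; rewrite mulf_eq0 negb_or => /andP[_ /w1]; rewrite lem_subDr.
  by under eq_bigr => j _ do rewrite -mulrA; rewrite -mulr_sumr w2 mulr1.
have [y /all_and2[Hy1 Hy2]] := fin_all_exists H.
exists (fun e t => y t e); split=> [e t|e t]; first exact: Hy1.
by rewrite (E0 e); exact: Hy2.
Qed.

(** * Staircases through the double complex *)

Implicit Types y : forall i, E i -> K.

(* A staircase from [x], of bidegree (i, p), up to a chain of bidegree (i + p, 0)
   whose coefficients on the generators of degree s are given by [y]. *)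
Fixpoint zigzag y p : forall i, (E i -> {set 'I_n} -> K) -> Prop :=
  if p is p'.+1 then fun i x => dchain p x /\
    exists x' : E i.+1 -> {set 'I_n} -> K,
      @zigzag y p' i.+1 x' /\ forall e t, hbd x' e t = vbd x e t
  else fun i x => dchain 0 x /\ forall e, deg e = s -> x e set0 = y i e.

Lemma zigzag_dchain y p i (x : E i -> {set 'I_n} -> K) :
  zigzag y p x -> dchain p x.
Proof. by case: p => [|p] []. Qed.

Lemma zigzag_hv y p i (x : E i.+1 -> {set 'I_n} -> K) e t :
  zigzag y p x -> hbd (vbd x) e t = 0.
Proof.
case: p => [[cx _]|p [_ [x' [_ h]]]]; last first.
  by rewrite -(eq_hbd h) hbd_hbd.
by apply: big1 => j _; rewrite vbd0 // mul0r.
Qed.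

(** The staircase is built from its far end: [hbd x'] is a vertical cycle with no component at
    generators of degree [s], hence has a vertical primitive. *)
Lemma zigzag_total y p i : exists x : E i -> {set 'I_n} -> K, zigzag y p x.
Proof.
elim: p i => [|p IHp] i /=.
  exists (fun e t => if (deg e == s) && (t == set0) then y i e else 0).
  split=> [e t|e ->]; last by rewrite !eqxx.
  case: ifP => [/andP[/eqP-> /eqP->] _|_]; last by rewrite eqxx.
  by rewrite cards0 mset_set0 addm0 lepm_refl.
have [x' zx'] := IHp i.+1; have cx' := zigzag_dchain zx'.
have [|||x [cx hx]] := @vbd_exact i p (hbd x').
- exact: dchain_hbd.
- by move=> e t; rewrite vbd_hbd (zigzag_hv _ _ zx').
- by move=> e t; apply: (hbd_top cx').
by exists x; split=> //; exists x'.
Qed.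

Lemma zigzagD y1 y2 a b p i (x1 x2 : E i -> {set 'I_n} -> K) :
  zigzag y1 p x1 -> zigzag y2 p x2 ->
  zigzag (fun i e => a * y1 i e + b * y2 i e) p
    (fun e t => a * x1 e t + b * x2 e t).
Proof.
elim: p i x1 x2 => [|p IHp] i x1 x2 /= [c1 h1] [c2 h2].
  by split=> [|e es]; [exact: dchainD|rewrite h1 // h2].
split; first exact: dchainD.
have [x1' [z1 e1]] := h1; have [x2' [z2 e2]] := h2.
exists (fun e t => a * x1' e t + b * x2' e t); split; first exact: IHp.
by move=> e t; rewrite hbdD vbdD e1 e2.
Qed.

(** A staircase ending in zero is a total boundary: once [x'] is written as [vbd b + hbd c], the
    difference [x - hbd b] is a vertical cycle and can be filled. *)
Lemma zigzag0 p i (x : E i -> {set 'I_n} -> K) : zigzag (fun _ _ => 0) p x ->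
  exists b c, [/\ dchain p.+1 b, dchain p c &
    forall e t, x e t = vbd b e t + hbd c e t].
Proof.
elim: p i x => [|p IHp] i x /= [cx].
  move=> hx; have [|e t|b [cb hb]] := @vbd_exact i 0 x cx.
  - by move=> e t; apply: vbd0.
  - move=> nz; have [/eqP] := cx _ _ nz; rewrite cards_eq0 => /eqP t0 _.
    by apply: contraNneq nz => /hx; rewrite t0 => ->.
  exists b, (fun _ _ => 0); split=> // [e t|e t]; first by rewrite eqxx.
  by rewrite -hb /hbd big1 ?addr0 // => j _; rewrite mul0r.
move=> [x' [/IHp[b [c [cb cc hx']]] hx]].
have [||e t nz|b' [cb' hb']] :=
  @vbd_exact i p.+1 (fun e t => 1 * x e t + (-1) * hbd b e t).
- exact: dchainD (dchain_hbd cb).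
- move=> e t; rewrite vbdD -hx.
  have -> : hbd x' e t = hbd (fun e t => 1 * vbd b e t + 1 * hbd c e t) e t.
    by apply: eq_hbd => e' t'; rewrite !mul1r.
  by rewrite hbdD hbd_hbd mulr0 addr0 !mul1r mulN1r vbd_hbd subrr.
(* Over a generator of degree [s] only the empty set fits below [s], while [t] has [p.+1]
   elements. *)
- have [/eqP ct] := dchainD cx (dchain_hbd cb) nz.
  apply: contraTneq => ->; apply/negP=> /mnm_lepP h.
  have /card_gt0P[v vt] : (0 < #|t|)%N by rewrite (eqP ct).
  by have := h v; rewrite !mnmE vt addn1 ltnn.
exists b', b; split=> // e t.
by rewrite -hb' mul1r mulN1r subrK.
Qed.

(** Converse of [zigzag0]: the primitive is pushed along the staircase, since [x' - vbd c] is a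
    horizontal cycle. At the far end neither boundary has a component at a generator of degree [s].
    The index [N] with its equation avoids a cast between [E (i + p.+1)] and [E (i.+1 + p)]. *)
Lemma zigzag_bound y p i (x b : E i -> {set 'I_n} -> K) c : zigzag y p x ->
  dchain p.+1 b -> dchain p c ->
  (forall e t, x e t = vbd b e t + hbd c e t) ->
  forall N, N = (i + p)%N -> forall e : E N, deg e = s -> y N e = 0.
Proof.
elim: p i x b c => [|p IHp] i x b c /= [cx].
  move=> hx cb cc h N; rewrite addn0 => {N}-> e es; rewrite -hx // h.
  have -> : vbd b e set0 = 0.
    apply: big1 => v _; have [->|/cb[_ /mnm_lepP/(_ v)]] := eqVneq (b e (v |: set0)) 0.
      by rewrite mulr0.
    by rewrite mnmDE es mnmE !inE eqxx addn1 ltnn.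
  rewrite add0r; apply/eqP; apply: contraT => /(hbd_top cc).
  by rewrite es eqxx.
move=> [x' [zx' hx']] cb cc h N; rewrite -addSnnS => eN.
have cx' := zigzag_dchain zx'.
have [||b' [cb' hb']] := @hbd_exact i p (fun e t => 1 * x' e t + (-1) * vbd c e t).
- exact: dchainD (dchain_vbd cc).
- move=> e t; rewrite hbdD hx'.
  have -> : vbd x e t = vbd (fun e t => 1 * vbd b e t + 1 * hbd c e t) e t.
    by apply: eq_vbd => e' t'; rewrite h !mul1r.
  by rewrite vbdD [vbd (vbd b) e t]kbd_kbd mulr0 add0r !mul1r mulN1r vbd_hbd subrr.
apply: (IHp _ x' c b' zx' cc cb') eN => e t.
by rewrite -hb' mul1r mulN1r addrC subrK.
Qed.

(** Exact rows continue the staircase to its far end, where zero data are correct because no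
    generator of degree [s] exists there. *)
Lemma zigzag_descend p i (x : E i.+1 -> {set 'I_n} -> K) : dchain p x ->
  (forall e t, hbd (vbd x) e t = 0) ->
  (forall N, N = (i.+1 + p)%N -> forall e : E N, deg e != s) ->
  zigzag (fun _ _ => 0) p x.
Proof.
elim: p i x => [|p IHp] i x cx hx hN /=.
  by split=> // e /eqP; rewrite (negbTE (hN i.+1 _ e)) // addn0.
split=> //; have [x' [cx' hx']] := hbd_exact (dchain_vbd cx) hx.
exists x'; split=> [|e t]; last by rewrite hx'.
apply: IHp => // [e t|N eN]; last by apply: hN; rewrite eN addSnnS.
by rewrite -vbd_hbd -(eq_vbd hx') [LHS]kbd_kbd.
Qed.

(* Cycles and boundaries of the Koszul complex of R/I in degree s: a monomial
   s - t lying in I is zero there. *)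
Definition kchain p (z : {set 'I_n} -> K) : Prop :=
  forall t, z t != 0 -> #|t| = p /\ (mset t <= s)%MM.

Definition kcycle p (z : {set 'I_n} -> K) : Prop := kchain p z /\
  forall t, (mset t <= s)%MM -> ~~ I (s - mset t)%MM -> kbd s z t = 0.

Definition kboundary p (z : {set 'I_n} -> K) : Prop :=
  exists2 b, kchain p.+1 b &
    forall t, (mset t <= s)%MM -> ~~ I (s - mset t)%MM -> z t = kbd s b t.

Lemma kchainE p z : kchain p z <-> dchain p (fun _ : E 0 => z).
Proof.
by split=> [h e t /h|h t /(h e0)]; rewrite ?(E0 e) deg0 add0m.
Qed.

Lemma hbd_I p (x : E 1 -> {set 'I_n} -> K) e t :
  dchain p x -> hbd x e t != 0 -> I (s - mset t)%MM.
Proof.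
move=> cx /sum_neq0[j _]; rewrite mulf_eq0 (E0 e) negb_or => /andP[/cx[_ h] /D0_I].
apply: I_up; rewrite lem_subDr //; exact: lepm_trans (lem_addl _ _) h.
Qed.

Lemma zigzag_kcycle y p x : zigzag y p.+1 x -> kcycle p.+1 (x e0).
Proof.
move=> [cx [x' [zx' h]]]; split=> [t /cx|t ts nI]; first by rewrite deg0 add0m.
rewrite -[LHS]/(vbd x e0 t) -h; apply/eqP; apply: contraT => nz.
by rewrite (hbd_I (zigzag_dchain zx') nz) in nI.
Qed.

(** If the starting chain bounds modulo [I], its difference from [vbd b] is supported where [s - t]
    lies in [I] and lifts to [E 1]; the staircase is then bounded and [zigzag_bound] applies. *)
Lemma zigzag_kboundary y p x : zigzag y p x -> kboundary p (x e0) ->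
  forall e : E p, deg e = s -> y p e = 0.
Proof.
move=> zx [b cb hb] e es.
have cb' : dchain p.+1 (fun _ : E 0 => b) by apply/kchainE.
have cx := zigzag_dchain zx.
have [|e' t|c [cc hc]] := @hbd_exact0 p
  (fun e t => 1 * x e t + (-1) * vbd (fun=> b) e t).
- exact: dchainD (dchain_vbd cb').
- move=> nz; apply: contraNT nz => nI; rewrite (E0 e') mul1r mulN1r subr_eq0.
  have [ts|nts] := boolP (mset t <= s)%MM; first by rewrite hb.
  have -> : x e0 t = 0.
    by apply/eqP; apply: contraNT nts => /cx[_]; rewrite deg0 add0m.
  rewrite eq_sym; apply: contraNT nts => /(dchain_vbd cb')[_].
  by rewrite deg0 add0m.
apply: (zigzag_bound zx cb' cc) es; last by rewrite add0n.
by move=> e' t; rewrite -hc mul1r mulN1r addrC subrK.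
Qed.

(** Comparing tagged elements gives a function on all the types [E i] at once, as a staircase
    requires. *)
Definition indicator p (k : E p) i (e : E i) : K :=
  (Tagged E e == Tagged E k)%:R.

Lemma indicator_same p (k l : E p) : indicator k l = (l == k)%:R.
Proof. by rewrite /indicator eq_Tagged. Qed.

(** A staircase ending in the indicator of a generator of degree [s] starts at a Koszul cycle, which
    cannot be a boundary. *)
Theorem no_generator p :
  (forall z, kcycle p.+1 z -> kboundary p.+1 z) ->
  forall k : E p.+1, deg k != s.
Proof.
move=> h k; apply/negP=> /eqP ks.
have [x zx] := zigzag_total (indicator k) p.+1 0.
have := zigzag_kboundary zx (h _ (zigzag_kcycle zx)) ks.
by rewrite indicator_same eqxx => /eqP; rewrite oner_eq0.
Qed.

(** The functional [phi] is injective on homology, so the homology has dimension at most one. *)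
Theorem generator_uniq p (phi : ({set 'I_n} -> K) -> K) :
  (forall a b z1 z2, phi (fun t => a * z1 t + b * z2 t) = a * phi z1 + b * phi z2) ->
  (forall z, kcycle p.+1 z -> phi z = 0 -> kboundary p.+1 z) ->
  forall k l : E p.+1, deg k = s -> deg l = s -> k = l.
Proof.
move=> lin h k l ks ls; apply/eqP; apply: contraT => nkl.
have [x1 z1] := zigzag_total (indicator k) p.+1 0.
have [x2 z2] := zigzag_total (indicator l) p.+1 0.
have nz x (y : forall i, E i -> K) m : zigzag y p.+1 x -> deg m = s -> y p.+1 m = 1 ->
    phi (x e0) != 0.
  move=> zx ms ym; apply/eqP=> /(h _ (zigzag_kcycle zx)) /(zigzag_kboundary zx)/(_ _ ms).
  by rewrite ym => /eqP; rewrite oner_eq0.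
(* This combination of the two cycles is killed by [phi], hence bounds; its coefficient at [k] is
   [phi (x2 e0)], which is nonzero. *)
have := zigzagD (phi (x2 e0)) (- phi (x1 e0)) z1 z2 => z.
have /h := zigzag_kcycle z; rewrite lin mulNr [phi (x2 _) * _]mulrC subrr => /(_ erefl).
move=> /(zigzag_kboundary z) /(_ k ks).
rewrite !indicator_same eqxx (negbTE nkl) mulr0 addr0 mulr1 => /eqP.
by rewrite (negbTE (nz _ _ l z2 ls _)) // indicator_same eqxx.
Qed.

(** Without a generator of degree [s], a staircase from [z] may end in zero, so [z] is
    [vbd b + hbd c]; the second term vanishes outside [I]. *)
Theorem generator_exists p z : kcycle p.+1 z -> ~ kboundary p.+1 z ->
  exists k : E p.+1, deg k == s.
Proof.
move=> [cz hz] nb; apply/existsP; apply: contraT; rewrite negb_exists => /forallP hk.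
case: nb; have cx : dchain p.+1 (fun _ : E 0 => z) by apply/kchainE.
have [|e t nz|x' [cx' hx']] := @hbd_exact0 p (vbd (fun=> z)).
- exact: dchain_vbd.
- have [_] := dchain_vbd cx nz; rewrite (E0 e) deg0 add0m => ts.
  by apply: contraNT nz => nI; apply/eqP; apply: hz nI.
have zx : zigzag (fun _ _ => 0) p.+1 (fun _ : E 0 => z).
  split=> //; exists x'; split=> [|e t]; last by rewrite hx'.
  apply: zigzag_descend => // [e t|N ->]; last by rewrite add1n.
  by rewrite -vbd_hbd -(eq_vbd hx') [LHS]kbd_kbd.
have [b [c [cb cc h]]] := zigzag0 zx.
exists (b e0) => [t /cb|t ts nI]; first by rewrite deg0 add0m.
rewrite (h e0); have [->|/(hbd_I cc)] := eqVneq (hbd c e0 t) 0; first by rewrite addr0.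
by rewrite (negbTE nI).
Qed.

End DoubleComplex.

(** * Cocycles on the edges of a graph *)

Section Walks.
Variables (T : finType) (K : zmodType) (e : rel T) (f : T -> T -> K).

Hypothesis e_sym : symmetric e.
Hypothesis e_irr : irreflexive e.
Hypothesis f_anti : forall a b, e a b -> f a b + f b a = 0.
Hypothesis f_cocycle : forall a b c, e a b -> e b c -> e c a ->
  f a b + f b c + f c a = 0.
Hypothesis no_induced_cycle : forall t (v : 'I_t -> T),
  (4 <= t)%N -> ~ induced_cycle e v.

Fixpoint walk_sum x p : K := if p is y :: p' then f x y + walk_sum y p' else 0.

Lemma walk_sum_cat x p q :
  walk_sum x (p ++ q) = walk_sum x p + walk_sum (last x p) q.
Proof. by elim: p x => [|y p IHp] x /=; rewrite ?add0r // IHp addrA. Qed.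

(** The bound [j - i + 2 <= size p] exempts only the pair of first and last positions, which are
    adjacent because the walk is closed. *)
Lemma chordless_walk_induced x p : (4 <= size p)%N -> path e x p -> last x p = x ->
  (forall i j, (i.+1 < j < size p)%N -> (j - i + 2 <= size p)%N ->
     ~~ ((nth x (x :: p) i == nth x (x :: p) j) ||
         e (nth x (x :: p) i) (nth x (x :: p) j))) ->
  induced_cycle e (fun a : 'I_(size p) => nth x (x :: p) a).
Proof.
set l := size p; set w := nth x (x :: p) => l4 ep lp nochord.
have stepw k : (k < l)%N -> e (w k) (w k.+1) by move/(pathP x): ep => /(_ k).
have wl : w l = w 0.
  by rewrite /w /= -[l]/((l.+1).-1) -{1}[l.+1]/(size (x :: p)) nth_last.
have near (a b : 'I_l) : (a < b)%N -> (w a == w b) || e (w a) (w b) ->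
    (b = a.+1 :> nat) \/ (a = 0 :> nat /\ b.+1 = l :> nat).
  move=> ab h; have bl := ltn_ord b.
  case: (ltngtP a.+1 b) => [ab2|ba|<-]; [|by lia|by left].
  right; have [|] := leqP (b - a + 2)%N l; last by lia.
  by move=> /nochord; rewrite ab2 bl h => /(_ isT).
have wS (a : 'I_l) : w (ordS a) = w a.+1.
  rewrite /=; have := ltn_ord a; rewrite leq_eqVlt => /orP[/eqP->|al].
    by rewrite modnn wl.
  by rewrite modn_small.
have inj (a b : 'I_l) : (a < b)%N -> w a <> w b.
  move=> ab wab; have [|bE|[aE bE]] := near a b ab; first by rewrite wab eqxx.
    by have := stepw a (ltn_ord a); rewrite -bE wab e_irr.
  by have := stepw b (ltn_ord b); rewrite bE wl -aE wab e_irr.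
have adj (a b : 'I_l) : (a < b)%N -> e (w a) (w b) -> b = ordS a \/ a = ordS b.
  move=> ab eab; have [|bE|[aE bE]] := near a b ab; first by rewrite eab orbT.
    by left; apply: val_inj; rewrite /= -bE modn_small.
  by right; apply: val_inj; rewrite /= bE modnn.
split; first exact: leq_trans l4.
- move=> a b wab; apply: val_inj; case: (ltngtP a b) => // h; first by case: (inj a b h).
  by case: (inj b a h).
- by move=> a; rewrite wS; apply: stepw.
- move=> a b eab; case: (ltngtP a b) => h.
  + exact: adj.
  + by have [||] := adj b a h; [rewrite e_sym | right | left].
  + by move: eab; rewrite h e_irr.
Qed.

(** Induction on length: a repeated vertex or a chord cuts the walk into two shorter closed walks,
    and a walk of length at least 4 without either would be an induced cycle. *)
Lemma closed_walk_sum0 x p : path e x p -> last x p = x -> walk_sum x p = 0.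
Proof.
have [l] := ubnP (size p); elim: l x p => // l IHl x p; rewrite ltnS => pl ep lp.
case: (ltnP (size p) 4) => [p4|p4].
  case: p p4 {pl} ep lp => [|a [|b [|c [|//]]]] //= _.
  - by rewrite andbT => xa ax; move: xa; rewrite ax e_irr.
  - by case/and3P=> xa _ _ ->; rewrite addr0; exact: f_anti.
  - case/and4P=> xa ab bc _ cx; move: bc; rewrite cx addr0 addrA => bc.
    exact: f_cocycle.
have [/existsP[i /existsP[j /and3P[ij ji h]]]|] := boolP [exists i : 'I_(size p),
  exists j : 'I_(size p), [&& i.+1 < j, j - i + 2 <= size p &
    (nth x (x :: p) i == nth x (x :: p) j) ||
         e (nth x (x :: p) i) (nth x (x :: p) j)]%N]; last first.
  rewrite negb_exists => /forallP h.
  case: (no_induced_cycle p4 (chordless_walk_induced p4 ep lp _)) => i j /andP[ij jp] ji.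
  have ip : (i < size p)%N by lia.
  have := h (Ordinal ip); rewrite negb_exists => /forallP/(_ (Ordinal jp)).
  by rewrite /= ij ji.
move: ij ji h (ltn_ord j); move: (nat_of_ord i) (nat_of_ord j) => {}i {}j ij ji h jp.
(* The three segments run from [x] to [a], from [a] to [b] and from [b] back to [x]; the bounds on
   [i] and [j] make both pieces shorter even after the chord is added. *)
pose p1 := take i p; pose p2 := take (j - i) (drop i p); pose p3 := drop j p.
have pE : p = p1 ++ p2 ++ p3.
  rewrite /p1 /p2 /p3 -[in drop j p](subnK (n := j) (m := i)); last by lia.
  by rewrite -drop_drop cat_take_drop cat_take_drop.
have nthE k : (k < size p)%N -> nth x (x :: p) k = last x (take k p).
  move=> kp; rewrite (last_nth x) size_take kp.
  by case: k kp => //= k kp; rewrite nth_take.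
have s1 : size p1 = i by rewrite size_takel //; lia.
have s3 : size p3 = (size p - j)%N by rewrite size_drop.
have s2 : size p2 = (j - i)%N by rewrite size_takel // size_drop; lia.
set a := last x p1; set b := last a p2.
have ea : nth x (x :: p) i = a by rewrite nthE //; lia.
have eb : nth x (x :: p) j = b.
  rewrite nthE // /b /a -last_cat; congr last.
  by rewrite [in LHS]pE catA take_size_cat // size_cat s1 s2; lia.
move: ep lp; rewrite pE !cat_path -/a -/b => /and3P[ep1 ep2 ep3].
rewrite !last_cat -/a -/b => lp3; rewrite !walk_sum_cat -/a -/b.
move: h; rewrite ea eb => /orP[/eqP ab|ab].
  rewrite (IHl a p2) // ?s2; last by lia.
  rewrite add0r -ab -walk_sum_cat; apply: IHl.
  + by rewrite size_cat s1 s3; lia.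
  + by rewrite cat_path ep1 -/a ab.
  + by rewrite last_cat -/a ab.
have h1 : walk_sum a (rcons p2 a) = 0.
  apply: IHl; last by rewrite last_rcons.
  + by rewrite size_rcons s2; lia.
  + by rewrite rcons_path ep2 -/b e_sym.
have h2 : walk_sum x (p1 ++ b :: p3) = 0.
  apply: IHl.
  + by rewrite size_cat /= s1 s3; lia.
  + by rewrite cat_path /= ep1 -/a ab.
  + by rewrite last_cat.
move: h1 h2; rewrite -cats1 !walk_sum_cat /= -/a -/b addr0 => h1 h2.
have := f_anti ab => h3.
have : walk_sum a p2 = f a b.
  by apply/eqP; rewrite -(inj_eq (addIr (f b a))) h1 h3.
by move->; rewrite h2.
Qed.

(** The potential at [b] is the sum along a chosen walk from the root of its component. *)
Lemma cocycle_is_coboundary : exists h, forall a b, e a b -> f a b = h b - h a.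
Proof.
have csym : connect_sym e by apply: sym_connect_sym.
have H b : exists p, path e (fingraph.root e b) p /\ last (fingraph.root e b) p = b.
  have := connect_root e b; rewrite csym => /connectP[p ep lp]; exists p.
  by rewrite -lp.
have [P /all_and2[P1 P2]] := fin_all_exists H.
exists (fun b => walk_sum (fingraph.root e b) (P b)) => a b eab.
have rab : fingraph.root e a = fingraph.root e b by apply/(fingraph.rootP csym)/connect1.
(* One return walk [q] from [b] to the root closes both the walk to [b] and the walk to [a] extended
   by the edge. *)
have /connectP[q eq lq] := connect_root e b.
have h1 : walk_sum (fingraph.root e b) (P b) + walk_sum b q = 0.
  rewrite -[X in walk_sum X q]P2 -walk_sum_cat closed_walk_sum0 //.
    by rewrite cat_path P1 P2.
  by rewrite last_cat P2.
have h2 : walk_sum (fingraph.root e a) (P a) + (f a b + walk_sum b q) = 0.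
  have -> : f a b + walk_sum b q = walk_sum (last (fingraph.root e a) (P a)) (b :: q).
    by rewrite P2.
  rewrite -walk_sum_cat closed_walk_sum0 //.
    by rewrite cat_path P1 P2 /= eab.
  by rewrite last_cat P2 /= rab.
apply/eqP; rewrite eq_sym subr_eq; apply/eqP/(addIr (walk_sum b q)).
by rewrite h1 -h2 addrCA addrA.
Qed.

End Walks.

(** * Monomial ideals and their resolutions *)

Section MonomialMembership.
Variables (n : nat) (K : fieldType).
Implicit Types (I : {mpoly K[n]} -> Prop) (S : seq 'X_{1..n}).

Definition mon_in S : pred 'X_{1..n} := fun m => has (fun g => (g <= m)%MM) S.

Lemma mon_in_up S m m' : (m <= m')%MM -> mon_in S m -> mon_in S m'.
Proof.
move=> mm' /hasP[g gS gm]; apply/hasP; exists g => //; exact: lepm_trans gm mm'.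
Qed.

Lemma mcoeffMX_le (p : {mpoly K[n]}) g m :
  (p * 'X_[g])@_m = if (g <= m)%MM then p@_(m - g) else 0.
Proof.
case: ifP => gm; first by rewrite -{1}(submK gm) addmC mcoeffMX.
apply/eqP; rewrite mcoeff_eq0 (perm_mem (msuppMX _ _)).
apply/negP=> /mapP[m' _ mE]; move: gm; rewrite mE.
by rewrite lem_addr.
Qed.

Lemma span_mon_in S (p : {mpoly K[n]}) m :
  monomial_span S p -> p@_m != 0 -> mon_in S m.
Proof.
move=> [c ->]; rewrite raddf_sum /=; apply: contraNT => /hasPn h.
rewrite big_seq big1 // => g /h gm; by rewrite mcoeffMX_le (negbTE gm).
Qed.

(* In [monomial_span] a coefficient depends on the monomial only, so repeated
   generators are weighted by their multiplicity, which may vanish in [K]. *)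
Lemma generated_uniq P I : generated_by_monomials P I ->
  exists2 S, all P S & (forall p, I p -> monomial_span S p) /\
    forall m, mon_in S m -> I 'X_[m].
Proof.
move=> [S PS hS]; pose mult g : K := (count_mem g S)%:R.
exists [seq g <- undup S | mult g != 0].
  by apply/allP => g; rewrite mem_filter mem_undup => /andP[_ /(allP PS)].
have spanE (c : 'X_{1..n} -> {mpoly K[n]}) : \sum_(g <- S) c g * 'X_[g] =
    \sum_(g <- undup S | mult g != 0) (mult g *: c g) * 'X_[g].
  rewrite -big_undup_iterop_count [RHS]big_mkcond /=; apply: eq_bigr => g _.
  rewrite Monoid.iteropE iter_addr_0 -scaler_nat.
  rewrite -/(mult g); case: eqP => [->|_] /=; first by rewrite scale0r.
  by rewrite -scalerAl.
split=> [p /hS[c ->]|m /hasP[g]].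
  by exists (fun g => mult g *: c g); rewrite spanE -big_filter.
rewrite mem_filter mem_undup => /andP[gm gS] gle; apply/hS.
exists (fun g' => if g' == g then (mult g)^-1 *: 'X_[m - g] else 0).
rewrite spanE big_mkcond (bigD1_seq g) ?undup_uniq ?mem_undup //= gm eqxx.
rewrite scalerA divff // scale1r -mpolyXD submK // big1 ?addr0 // => g' /negbTE->.
by rewrite scaler0 mul0r if_same.
Qed.

Lemma mdeg2_split (g : 'X_{1..n}) : mdeg g == 2%N ->
  exists i j, g = (U_(i) + U_(j))%MM.
Proof.
move=> g2; have /existsP[i gi] : [exists i, g i != 0%N].
  apply: contraLR g2; rewrite negb_exists => /forallP h.
  rewrite mdegE big1 // => i _; exact/eqP/negPn/h.
have ig : (U_(i) <= g)%MM by rewrite lep1mP.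
have gE := submK ig; have : mdeg (g - U_(i))%MM == 1%N.
  by move: g2; rewrite -{1}gE mdegD mdeg1 addn1 eqSS.
by case/mdeg1P=> j /eqP gj; exists j, i; rewrite -gj.
Qed.

Lemma mon_in_mdeg S m : all (fun m => mdeg m == 2%N) S -> mon_in S m ->
  (2 <= mdeg m)%N.
Proof.
move=> S2 /hasP[g gS gm]; rewrite -(submK gm) mdegD (eqP (allP S2 _ gS)).
exact: leq_addl.
Qed.

(** A squarefree generator dividing the square of a variable divides the variable itself, but [I]
    contains no monomial of degree below 2. *)
Lemma squarefree_no_square S I v : squarefree_ideal I ->
  all (fun m => mdeg m == 2%N) S -> (forall p, I p -> monomial_span S p) ->
  I 'X_[U_(v) + U_(v)] -> False.
Proof.
move=> /generated_uniq[S' sqS' [h1 h2]] S2 hS /h1 /(@span_mon_in _ _ (U_(v) + U_(v))%MM).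
rewrite mcoeffX eqxx oner_eq0 => /(_ isT) /hasP[g gS' /mnm_lepP gv].
have gle : (g <= U_(v))%MM.
  apply/mnm_lepP => i; have := gv i; have /forallP/(_ i) := allP sqS' _ gS'.
  by rewrite mnmDE mnm1E; case: (v == i).
have /h2/hS/(@span_mon_in _ _ g) : mon_in S' g.
  by apply/hasP; exists g => //; exact: lepm_refl.
rewrite mcoeffX eqxx oner_eq0 => /(_ isT) /(mon_in_mdeg S2).
by have := mdegD (U_(v) - g) g; rewrite submK // mdeg1 => e; rewrite leqNgt ltnS e leq_addl.
Qed.

End MonomialMembership.

(** * Multihomogeneous matrices and their scalar coefficients *)

Section HomogeneousMatrices.
Variables (n : nat) (K : fieldType).

Definition homog_mx a b (da : 'I_a -> 'X_{1..n}) (db : 'I_b -> 'X_{1..n})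
    (M : 'M[{mpoly K[n]}]_(a, b)) : Prop :=
  forall k l m, m \in msupp (M k l) -> (m + db l)%MM = da k.

(** The truncated subtraction is harmless: a homogeneous entry is zero unless [db l] divides
    [da k]. *)
Definition scal_mx a b (da : 'I_a -> 'X_{1..n}) (db : 'I_b -> 'X_{1..n})
    (M : 'M[{mpoly K[n]}]_(a, b)) k l : K := (M k l)@_(da k - db l).

Definition homog_row a (da : 'I_a -> 'X_{1..n}) m (u : 'I_a -> K) :
  'rV[{mpoly K[n]}]_a := \row_k (u k *: 'X_[m - da k]).

Section Fix.
Variables (a b : nat) (da : 'I_a -> 'X_{1..n}) (db : 'I_b -> 'X_{1..n}).
Variable M : 'M[{mpoly K[n]}]_(a, b).
Hypothesis hM : homog_mx da db M.

Lemma homog_mxE k l : M k l = scal_mx da db M k l *: 'X_[da k - db l].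
Proof.
apply/mpolyP=> m; rewrite mcoeffZ mcoeffX.
have [<-|ne] := eqVneq (da k - db l)%MM m; first by rewrite mulr1.
rewrite mulr0; apply/eqP; rewrite mcoeff_eq0.
by apply: contraNN ne => /hM <-; rewrite addmK.
Qed.

Lemma scal_mx_le k l : scal_mx da db M k l != 0 -> (db l <= da k)%MM.
Proof. by rewrite -mcoeff_msupp => /hM <-; exact: lem_addl. Qed.

Lemma homog_row_mul m u l : (forall k, u k != 0 -> (da k <= m)%MM) ->
  (homog_row da m u *m M) 0 l =
  (\sum_k u k * scal_mx da db M k l) *: 'X_[m - db l].
Proof.
move=> hu; rewrite mxE scaler_suml; apply: eq_bigr => k _.
rewrite mxE homog_mxE; have [->|/hu km] := eqVneq (u k) 0.
  by rewrite mul0r !scale0r mul0r.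
have [->|/scal_mx_le lk] := eqVneq (scal_mx da db M k l) 0.
  by rewrite mulr0 !scale0r mulr0.
rewrite -scalerAl -scalerAr scalerA -mpolyXD; congr (_ *: 'X_[_]).
by rewrite addmBA // submK.
Qed.

Lemma homog_row_ker m u : (forall k, u k != 0 -> (da k <= m)%MM) ->
  (forall l, \sum_k u k * scal_mx da db M k l = 0) ->
  homog_row da m u *m M = 0.
Proof.
move=> hu h; apply/rowP => l; rewrite homog_row_mul // h scale0r mxE //.
Qed.

Lemma homog_row_image m u (w : 'rV_a) : (forall l, u l != 0 -> (db l <= m)%MM) ->
  homog_row db m u = w *m M ->
  exists w' : 'I_a -> K, (forall k, w' k != 0 -> (da k <= m)%MM) /\
    forall l, u l = \sum_k w' k * scal_mx da db M k l.
Proof.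
(* The coefficients of [w] in degree [m] are extracted; the test on [da k] prevents truncated
   subtraction from producing a spurious one. *)
move=> hu e; exists (fun k => if (da k <= m)%MM then (w 0 k)@_(m - da k) else 0).
split=> [k|l]; first by case: ifP; rewrite ?eqxx.
have [lm|lm] := boolP (db l <= m)%MM; last first.
  rewrite big1 => [|k _]; first by apply/eqP; apply: contraNT lm => /hu.
  case: ifP => km; last by rewrite mul0r.
  have [->|/scal_mx_le lk] := eqVneq (scal_mx da db M k l) 0; first by rewrite mulr0.
  by rewrite (lepm_trans lk km) in lm.
have /rowP/(_ l) := e; rewrite !mxE => /(congr1 (mcoeff (m - db l)%MM)).
rewrite mcoeffZ mcoeffX eqxx mulr1 => ->; rewrite raddf_sum /=; apply: eq_bigr => k _.
rewrite homog_mxE; have [->|/scal_mx_le lk] := eqVneq (scal_mx da db M k l) 0.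
  by rewrite scale0r !mulr0 mcoeff0.
rewrite -scalerAr mcoeffZ mulrC mcoeffMX_le; congr (_ * _).
have -> : (da k - db l <= m - db l)%MM = (da k <= m)%MM.
  by rewrite lem_subDr // submK.
case: ifP => // km; congr (_ @_ _).
by rewrite submDA addmC submK.
Qed.

End Fix.

Lemma scal_mx_comp a b c (da : 'I_a -> 'X_{1..n}) (db : 'I_b -> 'X_{1..n})
    (dc : 'I_c -> 'X_{1..n}) (M : 'M_(a, b)) (N : 'M_(b, c)) k l :
  homog_mx da db M -> homog_mx db dc N -> row k M *m N = 0 ->
  \sum_j scal_mx da db M k j * scal_mx db dc N j l = 0.
Proof.
move=> hM hN e; apply/eqP.
have rE : row k M = homog_row db (da k) (scal_mx da db M k).
  by apply/rowP => j; rewrite !mxE (homog_mxE hM).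
move: e; rewrite rE => /rowP/(_ l).
rewrite (homog_row_mul hN) => [|j]; last exact: scal_mx_le.
rewrite mxE => /(congr1 (mcoeff (da k - dc l)%MM)) /eqP.
by rewrite mcoeffZ mcoeffX eqxx mulr1 mcoeff0.
Qed.

End HomogeneousMatrices.

(** * The resolution of R/I as a complex of scalar matrices *)

Section ResolutionComplex.
Variables (n : nat) (K : fieldType) (I : {mpoly K[n]} -> Prop).
Variable F : minimal_multigraded_resolution I.
Variable S : seq 'X_{1..n}.
Hypothesis S2 : all (fun m => mdeg m == 2%N) S.
Hypothesis I_span : forall p, I p -> monomial_span S p.
Hypothesis mon_I : forall m, mon_in S m -> I 'X_[m].

(* The resolution of R/I: the complex F shifted by one, with R in degree 0. *)
Definition rE i : finType := if i is j.+1 then 'I_(rk F j) else unit.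

Definition rdeg i : rE i -> 'X_{1..n} :=
  match i with 0 => fun=> 0%MM | j.+1 => fun k => @mdegree _ _ _ F j k end.

Definition rD i : rE i.+1 -> rE i -> K :=
  match i with
  | 0 => fun j _ => scal_mx (@mdegree _ _ _ F 0) (fun=> 0%MM) (aug F) j 0
  | i'.+1 => fun j k =>
      scal_mx (@mdegree _ _ _ F i'.+1) (@mdegree _ _ _ F i') (diff F i') j k
  end.

Lemma aug_homog : homog_mx (@mdegree _ _ _ F 0) (fun=> 0%MM) (aug F).
Proof.
by move=> k l m; rewrite (ord1 l) addm0; have [h _] := res_multigraded F; apply: h.
Qed.

Lemma diff_homog i :
  homog_mx (@mdegree _ _ _ F i.+1) (@mdegree _ _ _ F i) (diff F i).
Proof. by move=> j k m; have [_ h] := res_multigraded F; apply: h. Qed.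

Lemma mon_inP m : I 'X_[m] <-> mon_in S m.
Proof.
split=> [/I_span/span_mon_in h|]; last exact: mon_I.
by apply: h; rewrite mcoeffX eqxx oner_eq0.
Qed.

Lemma rD_D i (j : rE i.+2) (l : rE i) : \sum_k rD j k * rD k l = 0.
Proof.
have [_ h1 h2] := res_exact F; case: i j l => [|i] j l.
  apply: (scal_mx_comp _ (@diff_homog 0) aug_homog).
  by apply/h1; exists (delta_mx 0 j); rewrite rowE.
apply: (scal_mx_comp _ (@diff_homog i.+1) (@diff_homog i)).
by apply/h2; exists (delta_mx 0 j); rewrite rowE.
Qed.

Lemma rD0_in (j : rE 1) : rD j tt != 0 -> mon_in S (rdeg j).
Proof.
rewrite /= /scal_mx subm0 => nz.
apply: span_mon_in nz; apply: I_span; have [h _ _] := res_exact F.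
apply/h; exists (delta_mx 0 j); rewrite -rowE; apply/matrixP => a b.
by rewrite !ord1 !mxE eqxx.
Qed.

Lemma rD_lt i (j : rE i.+1) (k : rE i) :
  rD j k != 0 -> (rdeg k <= rdeg j)%MM /\ rdeg k != rdeg j.
Proof.
case: i j k => [|i] j k nz.
  split; first by apply/mnm_lepP => v; rewrite mnm0E.
  case: k nz => /rD0_in/(mon_in_mdeg S2).
  by apply: contraTneq => <-; rewrite mdeg0.
split; first by move: nz => /(scal_mx_le (@diff_homog i)).
(* Equal degrees would make the scalar a constant term, which is zero by minimality. *)
apply: contraNneq nz => /= e; rewrite /scal_mx e.
have -> : (mdegree j - mdegree j)%MM = 0%MM by apply/mnmP => v; rewrite mnmBE mnm0E subnn.
by rewrite (@res_minimal _ _ _ F).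
Qed.

Lemma rD_exact m i (u : rE i.+1 -> K) :
  (forall e, u e != 0 -> (rdeg e <= m)%MM) ->
  (forall l, \sum_k u k * rD k l = 0) ->
  exists w : rE i.+2 -> K, (forall e, w e != 0 -> (rdeg e <= m)%MM) /\
    forall k, u k = \sum_j w j * rD j k.
Proof.
have [_ h1 h2] := res_exact F; case: i u => [|i] u hu uD.
  have [|w hw] := (h1 (homog_row (@mdegree _ _ _ F 0) m u)).1.
    by apply: (homog_row_ker aug_homog) => // l; rewrite (ord1 l); apply: (uD tt).
  exact: (homog_row_image (@diff_homog 0) hu hw).
have [|w hw] := (h2 i (homog_row (@mdegree _ _ _ F i.+1) m u)).1.
  exact: (homog_row_ker (@diff_homog i)).
exact: (homog_row_image (@diff_homog i.+1) hu hw).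
Qed.

Lemma rD0_exact m : mon_in S m ->
  exists w : rE 1 -> K, (forall e, w e != 0 -> (rdeg e <= m)%MM) /\
    \sum_j w j * rD j tt = 1.
Proof.
move=> /mon_I; have [h _ _] := res_exact F => /h[u hu].
have [||w [w1 w2]] := @homog_row_image _ _ _ _ _ _ _ aug_homog m (fun=> 1) u.
- by move=> l _; apply/mnm_lepP => v; rewrite mnm0E.
- by rewrite -hu; apply/rowP => l; rewrite (ord1 l) !mxE subm0 scale1r eqxx.
by exists w; split=> //; rewrite (w2 0).
Qed.

Lemma rE0 (e : rE 0) : e = tt. Proof. by case: e. Qed.

Section Degree.
Variable s : 'X_{1..n}.

Lemma betti_eq0 p :
  (forall z : {set 'I_n} -> K, kcycle s (mon_in S) p.+1 z ->
     kboundary s (mon_in S) p.+1 z) ->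
  multigraded_betti F p s = 0%N.
Proof.
move=> h; apply/eqP; rewrite cards_eq0; apply/eqP/setP => k; rewrite !inE.
apply/negbTE; move: k.
exact: (no_generator rE0 erefl rD_D rD_lt rD_exact
  rD0_in rD0_exact (@mon_in_up n S) h).
Qed.

Lemma betti_le1 p (phi : ({set 'I_n} -> K) -> K) :
  (forall a b z1 z2, phi (fun t => a * z1 t + b * z2 t) = a * phi z1 + b * phi z2) ->
  (forall z : {set 'I_n} -> K, kcycle s (mon_in S) p.+1 z -> phi z = 0 ->
     kboundary s (mon_in S) p.+1 z) ->
  (multigraded_betti F p s <= 1)%N.
Proof.
move=> lin h; apply/card_le1_eqP => k l; rewrite !inE => /eqP ks /eqP ls.
exact: (generator_uniq rE0 erefl rD_D rD_lt rD_exact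
  rD0_in rD0_exact (@mon_in_up n S) lin h ls ks).
Qed.

Lemma betti_neq0 p (z : {set 'I_n} -> K) : kcycle s (mon_in S) p.+1 z ->
  ~ kboundary s (mon_in S) p.+1 z -> multigraded_betti F p s <> 0%N.
Proof.
move=> cz nb /eqP; rewrite cards_eq0 => /eqP/setP bE.
have [k ks] := generator_exists rE0 erefl rD_D rD_lt rD_exact
  rD0_in rD0_exact (@mon_in_up n S) cz nb.
by have := bE k; rewrite !inE ks.
Qed.

End Degree.
End ResolutionComplex.

(** * Cubic monomials in a quadratic monomial ideal *)

Section MsetTheory.
Variable n : nat.
Implicit Types (A B : {set 'I_n}) (a b c : 'I_n) (s : 'X_{1..n}).

Variable S : seq 'X_{1..n}.
Hypothesis S2 : all (fun m => mdeg m == 2%N) S.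

(** A quadratic generator dividing a cubic monomial leaves a single variable as cofactor. This is
    why the complex is determined by its edges up to dimension two. *)
Lemma mon_in3 a b c : mon_in S (U_(a) + U_(b) + U_(c))%MM =
  [|| mon_in S (U_(a) + U_(b))%MM, mon_in S (U_(a) + U_(c))%MM
    | mon_in S (U_(b) + U_(c))%MM].
Proof.
apply/idP/or3P => [/hasP[g gS gm]|]; last first.
  case; apply: mon_in_up; rewrite ?lem_addr //; first by rewrite -addmA addmCA lem_addl.
  by rewrite -addmA lem_addl.
have gin : mon_in S g by apply/hasP; exists g => //; exact: lepm_refl.
have : mdeg (U_(a) + U_(b) + U_(c) - g)%MM == 1%N.
  have := mdegD (U_(a) + U_(b) + U_(c) - g) g; rewrite submK // !mdegD !mdeg1.
  rewrite (eqP (allP S2 _ gS)); lia.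
case/mdeg1P=> k /eqP ek; have := submK gm; rewrite ek => e.
have : ((U_(a) + U_(b) + U_(c))%MM k != 0)%N by rewrite -e mnmDE mnm1E eqxx.
rewrite !mnmDE !mnm1E; case: (a =P k) => [ak|_].
  by constructor 3; move: e; rewrite ak -addmA => /addmI <-.
case: (b =P k) => [bk|_].
  by constructor 2; move: e; rewrite bk -addmA addmCA => /addmI <-.
case: (c =P k) => // ck _.
by constructor 1; move: e; rewrite ck [RHS]addmC => /addmI <-.
Qed.

End MsetTheory.

(** * Koszul chains as simplicial cochains *)

Section KoszulCochains.
Variables (n : nat) (K : fieldType) (s : 'X_{1..n}).
Implicit Types (z : {set 'I_n} -> K) (A : {set 'I_n}) (a b c : 'I_n).

Local Notation sigma := (mnm_supp s).
Local Notation exc := (s - mset sigma)%MM.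

(* Indexing by complements turns the Koszul differential into the simplicial
   coboundary. *)
Lemma kbd_compl z A : A \subset sigma -> kbd s z (sigma :\: A) =
  \sum_(v in A) (-1) ^+ #|[set w in A | (w < v)%N]| * z (sigma :\: (A :\ v)).
Proof.
move=> As; have AE : sigma :\: (sigma :\: A) = A.
  by rewrite setDDr setDv set0U; apply/setIidPr.
rewrite /kbd /ksign AE; apply: eq_bigr => v vA; congr (_ * z _).
apply/setP => w; rewrite !inE; case: (w =P v) => [->|] //=.
by have := subsetP As _ vA; rewrite !inE.
Qed.

Lemma kbd_compl1 z a : a \in sigma -> kbd s z (sigma :\ a) = z sigma.
Proof.
move=> as_; rewrite kbd_compl ?sub1set // big_set1.
have -> : [set w in [set a] | (w < a)%N] = set0.
  by apply/setP => w; rewrite !inE; case: eqP => // ->; rewrite ltnn.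
by rewrite cards0 mul1r setDv setD0.
Qed.

Lemma kbd_compl2 z a b : a \in sigma -> b \in sigma -> (a < b)%N ->
  kbd s z (sigma :\: [set a; b]) = z (sigma :\ b) - z (sigma :\ a).
Proof.
move=> as_ bs ab; have nab : a != b by rewrite -val_eqE neq_ltn ab.
rewrite kbd_compl; last by apply/subsetP => x /set2P[]->.
rewrite big_setU1 ?inE //= big_set1.
have -> : [set w in [set a; b] | (w < a)%N] = set0.
  apply/setP => w; rewrite !inE; apply/negbTE.
  by case: eqP => [->|_]; [|case: eqP => [->|//]]; lia.
have -> : [set w in [set a; b] | (w < b)%N] = [set a].
  by apply/setP => w; rewrite !inE; case: eqP => [->|_]; [|case: eqP => [->|//]]; lia.
have -> : [set a; b] :\ a = [set b] by rewrite setU1K // inE.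
have -> : [set a; b] :\ b = [set a] by rewrite setUC setU1K // inE eq_sym.
by rewrite cards0 cards1 mul1r expr1 mulN1r.
Qed.

Lemma kbd_compl3 z a b c : a \in sigma -> b \in sigma -> c \in sigma ->
  (a < b)%N -> (b < c)%N ->
  kbd s z (sigma :\: [set a; b; c]) =
  z (sigma :\: [set b; c]) - z (sigma :\: [set a; c]) + z (sigma :\: [set a; b]).
Proof.
move=> as_ bs cs ab bc; have nab : a != b by rewrite -val_eqE neq_ltn ab.
have nbc : b != c by rewrite -val_eqE neq_ltn bc.
have nac : a != c by rewrite -val_eqE neq_ltn (ltn_trans ab bc).
rewrite kbd_compl; last by rewrite !subUset !sub1set as_ bs cs.
rewrite -setUA big_setU1 ?inE ?negb_or ?nab //= big_setU1 ?inE //= big_set1.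
have lt_irr (x : 'I_n) : (x < x)%N = false by rewrite ltnn.
have ba : (b < a)%N = false by lia.
have ca : (c < a)%N = false by lia.
have cb : (c < b)%N = false by lia.
have ac : (a < c)%N by lia.
have -> : [set w in [set a] :|: [set b; c] | (w < a)%N] = set0.
  by apply/setP => w; rewrite !inE; do 3?case: eqP => [->|_] //=; rewrite ?andbF //.
have -> : [set w in [set a] :|: [set b; c] | (w < b)%N] = [set a].
  by apply/setP => w; rewrite !inE; do 3?case: eqP => [->|_] //=.
have -> : [set w in [set a] :|: [set b; c] | (w < c)%N] = [set a; b].
  by apply/setP => w; rewrite !inE; do 3?case: eqP => [->|_] //=.
have -> : ([set a] :|: [set b; c]) :\ a = [set b; c].
  by rewrite setU1K // !inE negb_or nab.
have -> : ([set a] :|: [set b; c]) :\ b = [set a; c].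
  by rewrite setUCA setU1K // !inE negb_or nbc eq_sym nab.
have -> : ([set a] :|: [set b; c]) :\ c = [set a; b].
  by rewrite setUA setUC setU1K // !inE negb_or ![c == _]eq_sym nac.
by rewrite cards0 cards1 cards2 nab /= expr0 expr1 sqrrN expr1n !mul1r mulN1r addrA.
Qed.

Variable S : seq 'X_{1..n}.

Lemma kcycle_compl p z A : kcycle s (mon_in S) p z -> A \subset sigma ->
  ~~ mon_in S (mset A + exc)%MM -> kbd s z (sigma :\: A) = 0.
Proof.
move=> [_ h] As nA; apply: h; last by rewrite mset_compl.
by rewrite mset_le subsetDl.
Qed.

(** The coboundary of the cochain concentrated on [B] is supported on the sets [u |: B], all of
    which are zero modulo [I]. *)
Lemma delta_kcycle (B : {set 'I_n}) : B \subset sigma ->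
  (forall u, u \in sigma :\: B -> mon_in S (mset (u |: B) + exc)%MM) ->
  kcycle s (mon_in S) #|sigma :\: B| (fun t => (t == sigma :\: B)%:R : K).
Proof.
move=> Bs hB; split=> t.
  case: (t =P _) => [-> _|_]; last by rewrite eqxx.
  by rewrite mset_le subsetDl.
rewrite mset_le => ts nI; apply/eqP; apply: contraNT nI.
case/sum_neq0=> u; rewrite inE => /andP[ut us].
rewrite mulf_eq0 negb_or => /andP[_].
case: (_ =P sigma :\: B) => [utE _|_]; last by rewrite eqxx.
have uB : u \in sigma :\: B by rewrite -utE setU11.
have -> : t = sigma :\: (u |: B) by rewrite setUC -setDDl -utE setU1K.
by rewrite mset_compl ?hB // subUset sub1set us.
Qed.

(** Only complements of sets of cardinality [p] need testing; in other cardinalities both sides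
    vanish. *)
Lemma kboundary_compl p z : kchain s p z -> (exists2 b : {set 'I_n} -> K,
   kchain s p.+1 b & forall A, A \subset sigma -> (#|A| + p = #|sigma|)%N ->
     ~~ mon_in S (mset A + exc)%MM -> z (sigma :\: A) = kbd s b (sigma :\: A)) ->
  kboundary s (mon_in S) p z.
Proof.
move=> cz [b cb h]; exists b => // t; rewrite mset_le => ts nI.
have tE : t = sigma :\: (sigma :\: t).
  by rewrite setDDr setDv set0U; apply/esym/setIidPr.
have [tp|tp] := eqVneq #|t| p.
  rewrite tE; apply: h; rewrite ?subsetDl //.
    by rewrite -tp cardsD (setIidPr ts) subnK // subset_leq_card.
  by rewrite -mset_compl ?subsetDl // -tE.
have -> : z t = 0 by apply/eqP; apply: contraNT tp => /cz[->].
rewrite /kbd big1 // => v; rewrite inE => /andP[vt _].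
have [->|/cb[]] := eqVneq (b (v |: t)) 0; first by rewrite mulr0.
by rewrite cardsU1 vt add1n => -[e]; rewrite e eqxx in tp.
Qed.

End KoszulCochains.

(** * Betti numbers of quadratic monomial ideals *)

Section SquarefreeDegree.
Variables (n : nat) (K : fieldType) (S : seq 'X_{1..n}) (V : {set 'I_n}).
Implicit Types (z : {set 'I_n} -> K) (A : {set 'I_n}) (a b c : 'I_n).

Definition co_edge a b : bool := (a != b) && ~~ mon_in S (U_(a) + U_(b))%MM.

Definition co_edge_in a b : bool := [&& a \in V, b \in V & co_edge a b].

(** The cochain on unordered pairs is made antisymmetric, the increasing order being positive. *)
Definition edge_val z a b : K :=
  if (a < b)%N then z (V :\: [set a; b])
  else if (b < a)%N then - z (V :\: [set a; b]) else 0.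

Lemma co_edge_sym a b : co_edge a b = co_edge b a.
Proof. by rewrite /co_edge eq_sym addmC. Qed.

Lemma co_edge_in_sym : symmetric co_edge_in.
Proof. by move=> a b; rewrite /co_edge_in co_edge_sym andbCA. Qed.

Lemma co_edge_in_irr : irreflexive co_edge_in.
Proof. by move=> a; rewrite /co_edge_in /co_edge eqxx !andbF. Qed.

Lemma edge_val_anti z a b : edge_val z a b = - edge_val z b a.
Proof.
by rewrite /edge_val setUC; case: (ltngtP a b); rewrite ?opprK ?oppr0.
Qed.

Lemma edge_valD z1 z2 x y a b :
  edge_val (fun t => x * z1 t + y * z2 t) a b = x * edge_val z1 a b + y * edge_val z2 a b.
Proof.
rewrite /edge_val; case: ltnP => // _; case: ltnP => // _; last by rewrite !mulr0 addr0.
by rewrite opprD !mulrN.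
Qed.

(** By [mon_in3] a triangle of the graph is a monomial outside [I], so the cycle condition holds
    there. Other orderings reduce to the increasing one by rotation and reversal. *)
Lemma edge_cocycle p z a b c : all (fun m => mdeg m == 2%N) S ->
  kcycle (mset V) (mon_in S) p z ->
  co_edge_in a b -> co_edge_in b c -> co_edge_in c a ->
  edge_val z a b + edge_val z b c + edge_val z c a = 0.
Proof.
move=> S2 cz.
have sorted_case (x y w : 'I_n) : (x < y)%N -> (y < w)%N ->
    co_edge_in x y -> co_edge_in y w -> co_edge_in w x ->
    edge_val z x y + edge_val z y w + edge_val z w x = 0.
  move=> xy yw /and3P[xV yV /andP[nxy exy]] /and3P[_ wV /andP[nyw eyw]].
  move=> /and3P[_ _ /andP[nwx ewx]].
  have sub : [set x; y; w] \subset mnm_supp (mset V).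
    by rewrite supp_mset; apply/subsetP => u; rewrite !inE => /orP[/orP[]|]/eqP->.
  have := kcycle_compl cz sub; rewrite kbd_compl3 ?supp_mset // subm_self addm0.
  have xw := ltn_trans xy yw; have wx : (w < x)%N = false by rewrite ltnNge ltnW.
  rewrite /edge_val xy yw wx xw [[set w; x]]setUC.
  rewrite -setUA msetU1 ?msetU1 ?mset1 ?inE ?negb_or ?nxy //; last by rewrite eq_sym.
  rewrite addmA mon_in3 // [(U_(x) + U_(w))%MM]addmC !negb_or exy eyw ewx.
  by move=> /(_ isT) <-; rewrite -addrA addrC.
have rot x y w : edge_val z x y + edge_val z y w + edge_val z w x =
    edge_val z y w + edge_val z w x + edge_val z x y by rewrite -addrA addrC.
have flip x y w : edge_val z x y + edge_val z y w + edge_val z w x =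
    - (edge_val z y x + edge_val z x w + edge_val z w y).
  by rewrite !opprD -!edge_val_anti addrAC.
move=> ab bc ca; have [ba cb ac] : [/\ co_edge_in b a, co_edge_in c b & co_edge_in a c].
  by split; rewrite co_edge_in_sym.
case: (ltngtP a b) => h1; case: (ltngtP b c) => h2; case: (ltngtP a c) => h3;
  try by [move: ab; rewrite (val_inj h1) co_edge_in_irr
         |move: bc; rewrite (val_inj h2) co_edge_in_irr
         |move: ac; rewrite (val_inj h3) co_edge_in_irr| lia].
- exact: sorted_case.
- by rewrite -(rot c a b) flip sorted_case ?oppr0.
- by rewrite -(rot c a b) sorted_case.
- by rewrite flip sorted_case ?oppr0.
- by rewrite rot sorted_case.
- by rewrite rot flip sorted_case ?oppr0.
Qed.

Lemma edge_val_lt z a b : (a < b)%N -> edge_val z a b = z (V :\: [set a; b]).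
Proof. by rewrite /edge_val => ->. Qed.

Lemma set2_sorted A : #|A| = 2%N -> exists a b, (a < b)%N /\ A = [set a; b].
Proof.
move/eqP/cards2P=> [a [b [nab ->]]]; case: (ltngtP a b) => h; first by exists a, b.
  by exists b, a; rewrite setUC.
by rewrite (val_inj h) eqxx in nab.
Qed.

Lemma co_edge_in_set2 a b : [set a; b] \subset V -> (a < b)%N ->
  ~~ mon_in S (mset [set a; b]) = co_edge_in a b.
Proof.
move=> /subsetP sV ab; have nab : a != b by rewrite -val_eqE neq_ltn ab.
by rewrite msetU1 ?mset1 ?inE // /co_edge_in /co_edge nab !sV ?inE ?eqxx ?orbT.
Qed.

Lemma potential_kboundary p z h : #|V| = p.+3 -> kchain (mset V) p.+1 z ->
  (forall a b, co_edge_in a b -> edge_val z a b = h b - h a) ->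
  kboundary (mset V) (mon_in S) p.+1 z.
Proof.
move=> cV cz hz; apply: kboundary_compl => //; rewrite supp_mset.
(* A set of [p.+2] elements omits one vertex of [V], so the sum is the value of [h] at that
   vertex. *)
exists (fun t : {set 'I_n} =>
  if (t \subset V) && (#|t| == p.+2) then \sum_(a in V :\: t) h a else 0).
  move=> t; case: ifP => [/andP[tV /eqP ->]|]; last by rewrite eqxx.
  by rewrite mset_le supp_mset.
move=> A AV; rewrite cV => cA.
have /set2_sorted[a [b [ab AE]]] : #|A| = 2%N by lia.
rewrite subm_self addm0 AE co_edge_in_set2 -?AE // => eab.
have [/and3P[aV bV _]] := eab.
rewrite AE -edge_val_lt // hz //.
have := @kbd_compl2 _ K (mset V) _ a b; rewrite supp_mset => -> //.
have D1 c : c \in V -> V :\: (V :\ c) = [set c].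
  by move=> cV'; rewrite setDDr setDv set0U; apply/setIidPr; rewrite sub1set.
have C1 c : c \in V -> #|V :\ c| == p.+2.
  by move=> cV'; move: cV; rewrite (cardsD1 c) cV' add1n => -[->].
by rewrite !subsetDl !C1 // !D1 // !big_set1.
Qed.

Lemma kboundary_potential p z : kboundary (mset V) (mon_in S) p.+1 z ->
  exists h, forall a b, co_edge_in a b -> edge_val z a b = h b - h a.
Proof.
move=> [b cb hb]; exists (fun a => b (V :\ a)).
have H a c : (a < c)%N -> co_edge_in a c ->
    edge_val z a c = b (V :\ c) - b (V :\ a).
  move=> ac eac; have [/and3P[aV cV _]] := eac.
  have sV : [set a; c] \subset V by apply/subsetP => u /set2P[]->.
  have := kbd_compl2 b (s := mset V) (a := a) (b := c); rewrite supp_mset.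
  move=> <- //; rewrite edge_val_lt // hb //; first by rewrite mset_le supp_mset subsetDl.
  have := @mset_compl _ (mset V) [set a; c]; rewrite supp_mset => -> //.
  by rewrite subm_self addm0 co_edge_in_set2.
move=> a c eac; case: (ltngtP a c) => ac; first exact: H.
  by rewrite edge_val_anti H ?opprB // co_edge_in_sym.
by move: eac; rewrite (val_inj ac) co_edge_in_irr.
Qed.

End SquarefreeDegree.

(** * The Betti number carried by an induced cycle *)

Section InducedCycle.
Variables (n : nat) (K : fieldType) (S : seq 'X_{1..n}) (p : nat).
Variable v : 'I_p.+3 -> 'I_n.
Hypothesis p_gt0 : (0 < p)%N.
Hypothesis v_cycle : induced_cycle (co_edge S) v.
Hypothesis S2 : all (fun m => mdeg m == 2%N) S.
Implicit Types (z : {set 'I_n} -> K) (a b c : 'I_p.+3).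

Local Notation V := [set v a | a : 'I_p.+3].

Lemma cycle_inj : injective v. Proof. by case: v_cycle. Qed.

Lemma card_cycle : #|V| = p.+3.
Proof. by rewrite card_imset ?card_ord //; exact: cycle_inj. Qed.

Lemma mset_cycle : (\sum_(a < p.+3) U_(v a))%MM = mset V.
Proof.
apply/mnmP => i; rewrite mnm_sumE mnmE.
under eq_bigr => a _ do rewrite mnm1E.
have [/imsetP[a _ ->]|iV] := boolP (i \in V).
  rewrite (bigD1 a) //= eqxx big1 // => b nb.
  by rewrite (inj_eq cycle_inj) (negbTE nb).
by rewrite big1 // => a _; case: eqP => // ai; case/negP: iV; rewrite -ai imset_f.
Qed.

Lemma cycle_edge a : co_edge_in S V (v a) (v (ordS a)).
Proof. by case: v_cycle => _ _ e _; rewrite /co_edge_in !imset_f // e. Qed.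

Definition holonomy z : K := \sum_a edge_val V z (v a) (v (ordS a)).

Lemma holonomyD x y z1 z2 :
  holonomy (fun t => x * z1 t + y * z2 t) = x * holonomy z1 + y * holonomy z2.
Proof.
rewrite /holonomy !mulr_sumr -big_split; apply: eq_bigr => a _; exact: edge_valD.
Qed.

Lemma holonomy_kboundary z :
  kboundary (mset V) (mon_in S) p.+1 z -> holonomy z = 0.
Proof.
move=> /kboundary_potential[h hz]; rewrite /holonomy.
under eq_bigr => a _ do rewrite hz ?cycle_edge //.
rewrite sumrB; apply/eqP; rewrite subr_eq0; apply/eqP.
by rewrite [RHS](reindex_inj (@ordS_inj p.+3)).
Qed.

(** Partial sums around the cycle form a potential; zero holonomy makes it consistent on the closing
    edge. *)
Lemma holonomy0_kboundary z : kchain (mset V) p.+1 z -> holonomy z = 0 ->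
  kboundary (mset V) (mon_in S) p.+1 z.
Proof.
move=> cz hol; pose g a := edge_val V z (v a) (v (ordS a)).
(* The value off the cycle is an arbitrary default. *)
pose h (x : 'I_n) : K :=
  if [pick a | v a == x] is Some a then \sum_(k : 'I_p.+3 | (k < a)%N) g k else 0.
have hE a : h (v a) = \sum_(k : 'I_p.+3 | (k < a)%N) g k.
  rewrite /h; case: pickP => [b /eqP/cycle_inj -> //|/(_ a)]; by rewrite eqxx.
have hS a : g a = h (v (ordS a)) - h (v a).
  rewrite !hE; have := ltn_ord a; rewrite leq_eqVlt => /orP[/eqP eqa|lta].
    rewrite [X in X - _]big1 => [|k]; last by rewrite /= eqa modnn.
    apply/eqP; rewrite sub0r -addr_eq0; move: hol; rewrite /holonomy (bigD1 a) //=.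
    move/eqP; congr (_ + _ == _); apply: eq_bigl => k; rewrite -val_eqE /=.
    by have := ltn_ord k; lia.
  rewrite [X in X - _](bigD1 a) /= ?modn_small //.
  rewrite [X in _ + X - _](eq_bigl (fun k : 'I__ => (k < a)%N)) ?addrK // => k.
  by rewrite -val_eqE /=; lia.
apply: (potential_kboundary card_cycle cz (h := h)) => x y /and3P[].
move=> /imsetP[a _ ->] /imsetP[b _ ->]; case: v_cycle => _ _ _ ind.
move=> /ind[->|->]; first exact: hS.
by rewrite edge_val_anti -/(g b) hS opprB.
Qed.

Definition one_edge (t : {set 'I_n}) : K :=
  (t == V :\: [set v ord0; v (ordS ord0)])%:R.

(** No triangle contains the edge: a third vertex would follow its end and precede its start, which
    requires length 3, whereas [0 < p]. *)
Lemma one_edge_kcycle : kcycle (mset V) (mon_in S) p.+1 one_edge.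
Proof.
set e := [set v ord0; v (ordS ord0)].
have eV : e \subset V by apply/subsetP => x /set2P[]->; apply: imset_f.
have ce : #|e| = 2%N by rewrite cards2 (inj_eq cycle_inj).
have := @delta_kcycle _ K (mset V) S e; rewrite supp_mset subm_self.
rewrite cardsD (setIidPr eV) card_cycle ce; apply=> // x /setDP[xV xe].
rewrite addm0 msetU1 // msetU1 ?mset1 ?inE ?(inj_eq cycle_inj) //.
rewrite addmA mon_in3 //; apply: contraNT xe; rewrite !negb_or => /and3P[n1 n2 _].
case/imsetP: xV => c _ xc; rewrite xc in n1 n2 *.
rewrite !inE !(inj_eq cycle_inj); apply: contraT; rewrite negb_or => /andP[c0 c1].
case: v_cycle => _ _ _ ind.
have e0 : co_edge S (v c) (v ord0) by rewrite /co_edge n1 (inj_eq cycle_inj) c0.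
have e1 : co_edge S (v c) (v (ordS ord0)) by rewrite /co_edge n2 (inj_eq cycle_inj) c1.
case: (ind _ _ e0) => [c00|cc]; last by rewrite cc eqxx in c1.
case: (ind _ _ e1) => [/ordS_inj cc|cc]; first by rewrite cc eqxx in c0.
by have := congr1 val c00; rewrite cc /= !modn_small //; lia.
Qed.

Lemma holonomy_one_edge : holonomy one_edge != 0.
Proof.
have V2 a b c d : V :\: [set v a; v b] = V :\: [set v c; v d] ->
    a \in [set c; d].
  move=> /setP/(_ (v a)); rewrite !inE imset_f // !andbT eqxx /= => /esym/negbFE.
  by rewrite !(inj_eq cycle_inj).
rewrite /holonomy (bigD1 ord0) //= big1 ?addr0 => [|a na].
  rewrite /edge_val /one_edge eqxx.
  have : v ord0 != v (ordS ord0) by rewrite (inj_eq cycle_inj).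
  by rewrite -val_eqE neq_ltn; case: ltngtP => //= _ _; rewrite ?oppr_eq0 oner_eq0.
have H : one_edge (V :\: [set v a; v (ordS a)]) = 0.
  rewrite /one_edge; case: eqP => // e; have := V2 _ _ _ _ e.
  rewrite setUC in e; have := V2 _ _ _ _ e; rewrite !inE (negbTE na) /= => h /eqP a1.
  by move: h; rewrite a1 -!val_eqE /= !modn_small //; lia.
by rewrite /edge_val H oppr0 !if_same.
Qed.

Lemma betti_induced_cycle (I : {mpoly K[n]} -> Prop)
    (F : minimal_multigraded_resolution I) :
  (forall q, I q -> monomial_span S q) -> (forall m, mon_in S m -> I 'X_[m]) ->
  multigraded_betti F p (\sum_(a < p.+3) U_(v a))%MM = 1%N.
Proof.
move=> IS SI; rewrite mset_cycle; apply/eqP; rewrite eqn_leq; apply/andP; split.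
  apply: (betti_le1 F S2 IS SI holonomyD).
  by move=> z [cz _]; apply: holonomy0_kboundary.
have nb : ~ kboundary (mset V) (mon_in S) p.+1 one_edge.
  by move=> /holonomy_kboundary/eqP; rewrite (negbTE holonomy_one_edge).
rewrite lt0n; apply/eqP; exact: (betti_neq0 S2 IS SI one_edge_kcycle nb).
Qed.

End InducedCycle.

(** * Non-squarefree multidegrees and the extraction of a cycle *)

Section QuadraticIdeal.
Variables (n : nat) (K : fieldType) (I : {mpoly K[n]} -> Prop).
Variable F : minimal_multigraded_resolution I.
Variable S : seq 'X_{1..n}.
Hypothesis S2 : all (fun m => mdeg m == 2%N) S.
Hypothesis I_span : forall p, I p -> monomial_span S p.
Hypothesis mon_I : forall m, mon_in S m -> I 'X_[m].
Implicit Types (s : 'X_{1..n}) (a b v w : 'I_n).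

Local Notation inI := (mon_in S).

(** With excess [v], the surviving vertices are [a] and [b] and no edge survives. The cochain
    concentrated on [a] is not constant, so it does not bound. *)
Lemma betti_square_edge v a b : v != a -> v != b -> a != b ->
  inI (U_(v) + U_(v))%MM -> ~~ inI (U_(a) + U_(v))%MM ->
  ~~ inI (U_(b) + U_(v))%MM -> inI (U_(a) + U_(b))%MM ->
  multigraded_betti F 1 (mset [set v; a; b] + U_(v))%MM <> 0%N.
Proof.
move=> nva nvb nab vv av bv ab; set A := [set v; a; b]; set s := (_ + _)%MM.
have sA : mnm_supp s = A.
  apply: supp_mset_add; apply/subsetP => i; rewrite !inE mnm1E.
  by case: eqP => // ->; rewrite eqxx.
have vA : v \in A by rewrite !inE eqxx.
have aA : a \in A by rewrite !inE eqxx orbT.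
have bA : b \in A by rewrite !inE eqxx !orbT.
have cA : #|A| = 3%N.
  by rewrite /A -setUA cardsU1 cards2 nab !inE negb_or nva nvb.
have := @delta_kcycle _ K s S [set a]; rewrite sA excess_add sub1set => cz.
have c2 : #|A :\ a| = 2%N by move: cA; rewrite (cardsD1 a) aA add1n => -[].
have {cz} := cz aA; rewrite c2 => cz; apply: (betti_neq0 S2 I_span mon_I (cz _)) => [u|].
  rewrite !inE => /andP[nua /orP[/orP[/eqP uv|ua]|/eqP ub]]; last 2 first.
  - by rewrite ua in nua.
  - by rewrite ub msetU1 ?mset1 ?inE -?ub // ub [(U_(b) + _)%MM]addmC mon_in3 // ab.
  - by rewrite uv msetU1 ?mset1 ?inE // mon_in3 // vv orbT.
move=> [h ch hh].
have H c : c \in A -> ~~ inI (U_(c) + U_(v))%MM -> (A :\ c == A :\ a)%:R = h A :> K.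
  move=> cA' ncv; have := @kbd_compl1 _ K s h c; rewrite sA => <- //.
  rewrite -hh //; first by rewrite mset_le sA subsetDl.
  by have := @mset_compl _ s [set c]; rewrite sA excess_add mset1 sub1set => ->.
have := H a aA av; rewrite eqxx -(H b bA bv).
have -> : (A :\ b == A :\ a) = false.
  by apply/negbTE/negP => /eqP/setP/(_ a); rewrite !inE nab eqxx orbT.
by move/eqP; rewrite oner_eq0.
Qed.

(** With excess [v + w], the empty set survives but no vertex does, which leaves a nonzero class on
    the empty set. *)
Lemma betti_two_squares v w : v != w -> inI (U_(v) + U_(v))%MM ->
  inI (U_(w) + U_(w))%MM -> ~~ inI (U_(v) + U_(w))%MM ->
  multigraded_betti F 1 (mset [set v; w] + (U_(v) + U_(w)))%MM <> 0%N.
Proof.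
move=> nvw vv ww vw; set A := [set v; w]; set s := (_ + _)%MM.
have sA : mnm_supp s = A.
  apply: supp_mset_add; apply/subsetP => i; rewrite !inE mnmDE !mnm1E ![i == _]eq_sym.
  by do 2!case: eqP.
have := @delta_kcycle _ K s S set0; rewrite sA excess_add sub0set setD0 cards2 nvw.
move=> /(_ isT) cz; apply: (betti_neq0 S2 I_span mon_I (cz _)) => [u|].
  rewrite setU0 mset1 => /set2P[]->; rewrite addmA mon_in3 ?vv // ww !orbT //.
move=> [h ch hh]; have := hh A; rewrite eqxx mset_le sA subxx excess_add => /(_ isT vw).
rewrite /kbd sA setDv big_set0 => /eqP; by rewrite oner_eq0.
Qed.

(** The relevant faces have cardinality 2 minus the degree of the excess [m]: vertices, the empty
    set, or nothing. *)
Lemma betti_nonsquarefree p s : mdeg s = p.+3 -> (s - mset (mnm_supp s))%MM != 0%MM ->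
  (forall s' v, (s' <= s)%MM -> mdeg s' = 4%N -> inI (U_(v) + U_(v))%MM ->
     multigraded_betti F 1 s' = 0%N) ->
  multigraded_betti F p s = 0%N.
Proof.
set A := mnm_supp s; set m := (s - _)%MM => ds m0 H.
have As : (mset A <= s)%MM by rewrite mset_le.
have sE : s = (mset A + m)%MM by rewrite addmC submK.
have dm : (#|A| + mdeg m = p.+3)%N by rewrite -ds {1}sE mdegD mdeg_mset.
have mA i : m i != 0%N -> i \in A by rewrite inE sE mnmDE; lia.
have dm0 : mdeg m != 0%N by rewrite mdeg_eq0.
apply: (betti_eq0 F S2 I_span mon_I) => z cz; have [zc _] := cz.
apply: kboundary_compl => //; rewrite -/A -/m.
have chain0 : kchain s p.+2 (fun=> 0 : K) by move=> t; rewrite eqxx.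
have kbd0 t : kbd s (fun=> 0 : K) t = 0 by apply: big1 => i _; rewrite mulr0.
have [dm1|] := eqVneq (mdeg m) 1%N.
  have /mdeg1P[v /eqP mE] := introT eqP dm1.
  have vA : v \in A by apply: mA; rewrite mE mnm1E eqxx.
  have cA : #|A| = p.+2 by lia.
  pose g a := z (A :\ a).
  have link a b : a \in A -> b \in A -> a != b ->
      ~~ inI (U_(a) + U_(b) + U_(v))%MM -> g a = g b.
    wlog ab : a b / (a < b)%N => [W|] aA bA nab nI.
      have := nab; rewrite -val_eqE neq_ltn => /orP[] lt; first exact: W.
      by apply/esym; apply: W => //; rewrite 1?eq_sym // (addmC U_(b)%MM).
    have sub : [set a; b] \subset mnm_supp s by apply/subsetP => i /set2P[]->.
    have := kcycle_compl cz sub; rewrite kbd_compl2 // -/A -/m mE msetU1 ?inE // mset1.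
    by move=> /(_ nI)/eqP; rewrite subr_eq0 => /eqP.
  (* Surviving vertices carry the same value: if the square of [v] is outside [I] they are all
     linked through [v]; otherwise two unlinked ones would contradict [betti_square_edge]. *)
  have gE a b : a \in A -> b \in A -> ~~ inI (U_(a) + U_(v))%MM ->
      ~~ inI (U_(b) + U_(v))%MM -> g a = g b.
    move=> aA bA av bv; have [vv|vv] := boolP (inI (U_(v) + U_(v))%MM); last first.
      have to_v c : c \in A -> ~~ inI (U_(c) + U_(v))%MM -> g c = g v.
        move=> cA' cv; have [->//|ncv] := eqVneq c v; apply: link => //.
        by rewrite mon_in3 // !negb_or cv vv.
      by rewrite !to_v.
    have [->//|nab] := eqVneq a b.
    have nva : v != a by apply: contraNneq av => <-.
    have nvb : v != b by apply: contraNneq bv => <-.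
    apply: link => //; rewrite mon_in3 // !negb_or av bv !andbT; apply/negP => ab.
    apply: (betti_square_edge nva nvb nab vv av bv ab); apply: H vv; last first.
      by rewrite mdegD mdeg1 mdeg_mset -setUA cardsU1 cards2 nab !inE negb_or nva nvb.
    rewrite sE mE; apply: lem_add2; last exact: lepm_refl.
    by apply: mset_sub; rewrite !subUset !sub1set vA aA.
  have [a /andP[aA av]|no] := pickP (fun a => (a \in A) && ~~ inI (U_(a) + U_(v))%MM).
    exists (fun t => if t == A then g a else 0).
      move=> t; case: (t =P A) => [-> _|_]; last by rewrite eqxx.
      by rewrite cA mset_le subxx.
    move=> B BA cB; have /eqP/cards1P[b BE] : #|B| = 1%N by lia.
    have bA : b \in A by rewrite -sub1set -BE.
    rewrite BE mset1 mE kbd_compl1 // eqxx => bv; exact: gE.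
  exists (fun=> 0) => // B BA cB; have /eqP/cards1P[b BE] : #|B| = 1%N by lia.
  have bA : b \in A by rewrite -sub1set -BE.
  by have := no b; rewrite BE mset1 mE bA /= => /negbFE->.
have [dm2 _|dm2 dm1] := eqVneq (mdeg m) 2%N; last first.
  by exists (fun=> 0) => // B BA cB; lia.
exists (fun=> 0) => // B BA cB nI; have B0 : B = set0.
  by apply/eqP; rewrite -cards_eq0; lia.
move: nI; rewrite kbd0 B0 setD0 mset_set0 add0m.
have [v [w mE]] := mdeg2_split (introT eqP dm2); rewrite mE => nvw.
have vA : v \in A by apply: mA; rewrite mE mnmDE mnm1E eqxx.
have wA : w \in A by apply: mA; rewrite mE mnmDE !mnm1E eqxx addn1.
(* Any surviving vertex forces [z A] to vanish; if neither [v] nor [w] survives, both squares lie in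
   [I]. *)
have zu u : u \in A -> ~~ inI (U_(u) + (U_(v) + U_(w)))%MM -> z A = 0.
  move=> uA nI; have sub : [set u] \subset mnm_supp s by rewrite sub1set.
  by have := kcycle_compl cz sub; rewrite kbd_compl1 // -/A -/m mE mset1; apply.
have [vv|vv] := boolP (inI (U_(v) + U_(v))%MM); last first.
  by apply: (zu v) => //; rewrite addmA mon_in3 // !negb_or vv nvw.
have [ww|ww] := boolP (inI (U_(w) + U_(w))%MM); last first.
  by apply: (zu w) => //; rewrite addmA mon_in3 // !negb_or ww nvw addmC nvw.
have nvw' : v != w by apply: contraNneq nvw => <-.
case: (betti_two_squares nvw' vv ww nvw); apply: H vv.
  rewrite sE mE; apply: lem_add2; last exact: lepm_refl.
  by apply: mset_sub; rewrite subUset !sub1set vA.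
by rewrite !mdegD !mdeg1 mdeg_mset cards2 nvw'.
Qed.

Lemma compl_graphE a b : compl_graph I a b <-> co_edge S a b.
Proof.
rewrite /compl_graph /graph_of -mpolyXD mon_inP; last 2 first.
- exact: I_span.
- exact: mon_I.
by split=> [[nab /negP nI]|/andP[nab /negP nI]]; [apply/andP|].
Qed.

Lemma nonlinear_of_betti p s : mdeg s = p.+3 -> multigraded_betti F p s <> 0%N ->
  has_nonlinear_betti (coarsen F) p.+3.
Proof.
move=> ds /eqP b; exists p; first by rewrite addn3.
apply/eqP; move: b; rewrite !cards_eq0 => /set0Pn[k]; rewrite inE => /eqP ks.
by apply/set0Pn; exists k; rewrite inE /= ks ds.
Qed.

(** If no induced cycle uses exactly the support, every class in multidegree [s] is shown to bound.
    The conclusion [0 < p] also excludes the value 3 for r. *)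
Lemma betti_to_cycle p s :
  (forall r', has_nonlinear_betti (coarsen F) r' -> (p.+3 <= r')%N) ->
  (p = 1%N -> squarefree_ideal I) -> mdeg s = p.+3 ->
  multigraded_betti F p s <> 0%N ->
  (0 < p)%N /\ exists2 v : 'I_p.+3 -> 'I_n, induced_cycle (co_edge S) v
    & s = (\sum_(a < p.+3) U_(v a))%MM.
Proof.
move=> rmin hsq ds nb; apply: NNPP => ncycle; apply: nb.
have [exc0|exc0] := eqVneq (s - mset (mnm_supp s))%MM 0%MM; last first.
  apply: betti_nonsquarefree => // s' v s's ds' vv; apply/eqP; apply: contraT => /eqP b'.
  (* Minimality and [s' <= s] force total degree 4, where squarefreeness forbids a square in [I]. *)
  have p1 : (p.+3 <= 4)%N by apply: rmin; apply: nonlinear_of_betti b'.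
  have p1' : (4 <= p.+3)%N by rewrite -ds' -ds -(submK s's) mdegD leq_addl.
  have /hsq sq : p = 1%N by lia.
  by case: (squarefree_no_square sq S2 I_span (mon_I vv)).
set V := mnm_supp s in exc0; have sE : s = mset V.
  by rewrite -[LHS](submK (m := mset V)) ?mset_le // exc0 add0m.
have cV : #|V| = p.+3 by rewrite -ds sE mdeg_mset.
rewrite sE; apply: (betti_eq0 F S2 I_span mon_I) => z cz.
have [|a b ab|a b c|t v t4 iv|h hz] :=
  @cocycle_is_coboundary 'I_n K (co_edge_in S V) (edge_val V z) (@co_edge_in_sym _ S V).
- exact: co_edge_in_irr.
- by rewrite edge_val_anti addNr.
- exact: (edge_cocycle S2 cz).
- case: t v t4 iv => [|[|[|q]]] // v q0 [_ inj adj ind].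
  have vV (k : 'I_q.+3) : v k \in V by case/and3P: (adj k).
  have iv : induced_cycle (co_edge S) v.
    by split=> // [a|a b e]; [case/and3P: (adj a)|apply: ind; rewrite /co_edge_in !vV].
  (* The cycle lies in [V], so it is no longer than [V] is large; its own Betti number and
     minimality give the reverse inequality. *)
  have qp : (q <= p)%N.
    rewrite -(leq_add2r 3) !addn3 -cV -[q.+3]card_ord -(card_codom inj).
    by apply/subset_leq_card/subsetP => x /codomP[a ->].
  have pq : (p.+3 <= q.+3)%N.
    apply: rmin; apply: (@nonlinear_of_betti _ (\sum_(a < q.+3) U_(v a))%MM).
      rewrite mdeg_sum (eq_bigr (fun=> 1%N)) => [|a _]; last by rewrite mdeg1.
      by rewrite sum1_card card_ord.
    by rewrite (betti_induced_cycle q0 iv S2 F I_span mon_I).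
  have eqp : q = p by lia.
  subst q; apply: ncycle; split=> //; exists v => //; rewrite (mset_cycle iv).
  rewrite sE; congr mset; apply/esym/eqP; rewrite eqEcard (card_cycle iv) cV leqnn andbT.
  by apply/subsetP => x /imsetP[a _ ->].
by apply: potential_kboundary hz => //; case: cz.
Qed.

End QuadraticIdeal.

(** * Induced cycles and the first nonlinear degree *)

Theorem mainTheorem3 (n : nat) (K : fieldType) (I : {mpoly K[n]} -> Prop)
    (F : minimal_multigraded_resolution I) (r : nat)
    (hI : quadratic_monomial_ideal I)
    (hlin : ~ linear_resolution (coarsen F))
    (hr : first_nonlinear_degree (coarsen F) r)
    (hsqf : r = 4%N -> squarefree_ideal I)
    (s : 'X_{1..n}) (hs : mdeg s = r) :
  (multigraded_betti F (r - 3)%N s <> 0%N <-> supported_on_induced_cycle I r s) /\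
  (supported_on_induced_cycle I r s -> multigraded_betti F (r - 3)%N s = 1%N).
Proof.
have [S S2 [IS SI]] := generated_uniq hI; have [[i ir bi] rmin] := hr.
have [p rE] : exists p, r = p.+3 by exists (r - 3)%N; lia.
rewrite {}rE in ir bi rmin hsqf hs *.
have hsq : p = 1%N -> squarefree_ideal I by move=> p1; apply: hsqf; rewrite p1.
have toC := betti_to_cycle S2 IS SI rmin hsq.
(* If [p] were 0, then [i] would be 0 and a generator of degree 3 would contradict
   [betti_to_cycle]. *)
have p0 : (0 < p)%N.
  rewrite lt0n; apply/eqP => p0; apply: bi; apply/eqP; rewrite cards_eq0.
  apply/eqP/setP => k; rewrite !inE; apply/negbTE/negP => /eqP dk.
  have i0 : i = p by lia.
  subst i; have [|pos _] := toC _ dk; last by move: pos; rewrite p0.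
  by apply/eqP; rewrite cards_eq0; apply/set0Pn; exists k; rewrite inE.
have iffE := compl_graphE IS SI.
have indE (v : 'I_p.+3 -> 'I_n) :
    induced_cycle (compl_graph I) v <-> induced_cycle (co_edge S) v.
  by split=> -[h1 h2 h3 h4]; split=> // [a|a b /iffE/h4 //]; apply/iffE.
have XE (v : 'I_p.+3 -> 'I_n) : 'X_[s] = \prod_(a < p.+3) 'X_(v a) :> {mpoly K[n]} <->
    s = (\sum_(a < p.+3) U_(v a))%MM.
  have -> : \prod_(a < p.+3) 'X_(v a) = 'X_[\sum_(a < p.+3) U_(v a)] :> {mpoly K[n]}.
    apply/esym/(big_morph (fun m : 'X_{1..n} => 'X_[m] : {mpoly K[n]})).
      exact: mpolyXD.
    exact: mpolyX0.
  split=> [/(congr1 (mcoeff s))|-> //]; rewrite !mcoeffX eqxx.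
  by case: (_ =P s) => [->|_] // /eqP; rewrite oner_eq0.
have fromC : supported_on_induced_cycle I p.+3 s -> multigraded_betti F p s = 1%N.
  by move=> [v /indE iv /XE ->]; exact: (betti_induced_cycle p0 iv S2 F IS SI).
rewrite -[p.+3]addn3 addnK addn3; split=> //; split=> [|/fromC -> //].
by move=> /toC[//|_ [v iv sE]]; exists v; [apply/indE|apply/XE].
Qed.
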